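(* Let $(b,c)$ be a connected canonically compactifiable weighted graph over $X$. Then for every $\varphi\in C_0(\partial X)$ there exists a unique $u\in\mathcal A$ such that $$\mathcal Lu=0\ \text{ on }X\qquad\text{and}\qquad \hat u|_{\partial X}=\varphi.$$
   Context: Let $X$ be a countably infinite set. A weighted graph $(b,c)$ over $X$ consists of a symmetric $b:X\times X\to[0,\infty)$ with $b(x,x)=0$ and $\sum_{y}b(x,y)<\infty$ for all $x$, and $c:X\to[0,\infty)$; connected means any two distinct vertices are joined by a finite path of pairwise distinct vertices with consecutive ones satisfying $b>0$. For bounded $f$, $\mathcal Lf(x)=\sum_y b(x,y)(f(x)-f(y))+c(x)f(x)$. Let $\widetilde Q(f)=\frac12\sum_{x,y}b(x,y)|f(x)-f(y)|^2+\sum_x c(x)|f(x)|^2$ and $\widetilde D=\{f:\widetilde Q(f)<\infty\}$; the graph is canonically compactifiable if $\widetilde D\subseteq\ell^\infty(X)$. Let $\mathcal A$ be the sup-norm closure of $\widetilde D$ in $\ell^\infty(X)$, $\mathcal A^+$ the smallest $C^*$-subalgebra of $\ell^\infty(X)$ containing $\mathcal A$ and $1$, $K$ the set of characters (nonzero multiplicative linear functionals) of $\mathcal A^+$ with the weak-$*$ topology, and $\hat g(\gamma)=\gamma(g)$. Via $x\mapsto\delta_x$ ($\delta_x(f)=f(x)$) view $X\subseteq K$ and set $\partial X=K\setminus X$. If $\sum_x c(x)<\infty$, set $C_0(\partial X)=C(\partial X)$. Otherwise $1\notin\mathcal A$, there is a character $\gamma_\infty\in\partial X$ defined by $\gamma_\infty(g+\alpha1)=\alpha$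 for $g\in\mathcal A$, $\alpha\in\mathbb C$, and $C_0(\partial X)=\{\varphi\in C(\partial X):\varphi(\gamma_\infty)=0\}$. *)

(* Defs.v *)
From Stdlib Require Import Reals List Classical ClassicalEpsilon FunctionalExtensionality.
Import ListNotations.
Open Scope R_scope.

Record Cplx := mkC { re : R ; im : R }.
Definition C0 : Cplx := mkC 0 0.
Definition C1 : Cplx := mkC 1 0.
Definition RtoC (r : R) : Cplx := mkC r 0.
Definition Cadd (z w : Cplx) : Cplx := mkC (re z + re w) (im z + im w).
Definition Copp (z : Cplx) : Cplx := mkC (- re z) (- im z).
Definition Csub (z w : Cplx) : Cplx := Cadd z (Copp w).
Definition Cmul (z w : Cplx) : Cplx :=
  mkC (re z * re w - im z * im w) (re z * im w + im z * re w).
Definition Cconj (z : Cplx) : Cplx := mkC (re z) (- im z).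
Definition Cmod (z : Cplx) : R := sqrt (re z * re z + im z * im z).

Definition Rsum_list {T : Type} (f : T -> R) (l : list T) : R :=
  fold_right (fun t acc => f t + acc) 0 l.
Definition Csum_list {T : Type} (f : T -> Cplx) (l : list T) : Cplx :=
  fold_right (fun t acc => Cadd (f t) acc) C0 l.

Definition summable_nonneg {T : Type} (f : T -> R) : Prop :=
  exists M : R, forall l : list T, NoDup l -> Rsum_list f l <= M.

Definition C_has_sum {T : Type} (f : T -> Cplx) (s : Cplx) : Prop :=
  forall eps : R, 0 < eps -> exists l0 : list T, forall l : list T,
    NoDup l -> incl l0 l -> Cmod (Csub (Csum_list f l) s) < eps.

Definition Ctsum {T : Type} (f : T -> Cplx) : Cplx :=
  epsilon (inhabits C0) (fun s => C_has_sum f s).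

Definition countably_infinite (X : Type) : Prop :=
  exists e : nat -> X, (forall n m, e n = e m -> n = m) /\ (forall x, exists n, e n = x).

Definition weighted_graph {X : Type} (b : X -> X -> R) (c : X -> R) : Prop :=
  (forall x y, 0 <= b x y) /\ (forall x y, b x y = b y x) /\ (forall x, b x x = 0)
  /\ (forall x, summable_nonneg (b x)) /\ (forall x, 0 <= c x).

Fixpoint b_chain {X : Type} (b : X -> X -> R) (l : list X) : Prop :=
  match l with
  | x :: ((y :: _) as l') => 0 < b x y /\ b_chain b l'
  | _ => True
  end.

Definition connected {X : Type} (b : X -> X -> R) : Prop :=
  forall x y : X, x <> y -> exists l : list X,
    NoDup (x :: l ++ [y]) /\ b_chain b (x :: l ++ [y]).

Definition Lap {X : Type} (b : X -> X -> R) (c : X -> R) (f : X -> Cplx) (x : X) : Cplx :=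
  Cadd (Ctsum (fun y => Cmul (RtoC (b x y)) (Csub (f x) (f y))))
       (Cmul (RtoC (c x)) (f x)).

Definition Qfinite {X : Type} (b : X -> X -> R) (c : X -> R) (f : X -> Cplx) : Prop :=
  summable_nonneg (fun p : X * X => b (fst p) (snd p) * (Cmod (Csub (f (fst p)) (f (snd p))))^2)
  /\ summable_nonneg (fun x => c x * (Cmod (f x))^2).

Definition bounded {X : Type} (f : X -> Cplx) : Prop :=
  exists M : R, forall x, Cmod (f x) <= M.

Definition canonically_compactifiable {X : Type} (b : X -> X -> R) (c : X -> R) : Prop :=
  forall f : X -> Cplx, Qfinite b c f -> bounded f.

Definition in_sup_closure {X : Type} (S : (X -> Cplx) -> Prop) (g : X -> Cplx) : Prop :=
  bounded g /\ forall eps : R, 0 < eps ->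
    exists f, S f /\ forall x, Cmod (Csub (g x) (f x)) <= eps.

Definition inA {X : Type} (b : X -> X -> R) (c : X -> R) (g : X -> Cplx) : Prop :=
  in_sup_closure (fun f => Qfinite b c f /\ bounded f) g.

Definition one {X : Type} : X -> Cplx := fun _ => C1.

Definition Cstar_subalgebra {X : Type} (S : (X -> Cplx) -> Prop) : Prop :=
  (forall f, S f -> bounded f)
  /\ S (fun _ => C0)
  /\ (forall f g, S f -> S g -> S (fun x => Cadd (f x) (g x)))
  /\ (forall (a : Cplx) f, S f -> S (fun x => Cmul a (f x)))
  /\ (forall f g, S f -> S g -> S (fun x => Cmul (f x) (g x)))
  /\ (forall f, S f -> S (fun x => Cconj (f x)))
  /\ (forall g, in_sup_closure S g -> S g).

Definition inAplus {X : Type} (b : X -> X -> R) (c : X -> R) (g : X -> Cplx) : Prop :=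
  forall S : (X -> Cplx) -> Prop, Cstar_subalgebra S ->
    (forall f, inA b c f -> S f) -> S one -> S g.

(* characters of A^+ (functionals are only relevant on A^+) *)
Definition character {X : Type} (b : X -> X -> R) (c : X -> R)
  (gam : (X -> Cplx) -> Cplx) : Prop :=
  (forall f g, inAplus b c f -> inAplus b c g ->
     gam (fun x => Cadd (f x) (g x)) = Cadd (gam f) (gam g))
  /\ (forall (a : Cplx) f, inAplus b c f -> gam (fun x => Cmul a (f x)) = Cmul a (gam f))
  /\ (forall f g, inAplus b c f -> inAplus b c g ->
     gam (fun x => Cmul (f x) (g x)) = Cmul (gam f) (gam g))
  /\ (exists f, inAplus b c f /\ gam f <> C0).

Definition delta {X : Type} (x : X) : (X -> Cplx) -> Cplx := fun f => f x.

Definition char_eq {X : Type} (b : X -> X -> R) (c : X -> R)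
  (g1 g2 : (X -> Cplx) -> Cplx) : Prop :=
  forall f, inAplus b c f -> g1 f = g2 f.

Definition in_boundary {X : Type} (b : X -> X -> R) (c : X -> R)
  (gam : (X -> Cplx) -> Cplx) : Prop :=
  character b c gam /\ forall x : X, ~ char_eq b c gam (delta x).

(* continuity on the boundary w.r.t. the (relative) weak-* topology *)
Definition continuous_on_boundary {X : Type} (b : X -> X -> R) (c : X -> R)
  (phi : ((X -> Cplx) -> Cplx) -> Cplx) : Prop :=
  forall gam0, in_boundary b c gam0 ->
  forall eps : R, 0 < eps ->
    exists (fs : list (X -> Cplx)) (del : R), 0 < del /\ (forall f, In f fs -> inAplus b c f) /\
      forall gam, in_boundary b c gam ->
        (forall f, In f fs -> Cmod (Csub (gam f) (gam0 f)) < del) ->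
        Cmod (Csub (phi gam) (phi gam0)) < eps.

(* gamma_infinity (g + alpha 1) = alpha, g in A *)
Definition gamma_inf {X : Type} (b : X -> X -> R) (c : X -> R) : (X -> Cplx) -> Cplx :=
  fun g => epsilon (inhabits C0) (fun a => inA b c (fun x => Csub (g x) a)).

Definition in_C0_boundary {X : Type} (b : X -> X -> R) (c : X -> R)
  (phi : ((X -> Cplx) -> Cplx) -> Cplx) : Prop :=
  continuous_on_boundary b c phi /\
  (~ summable_nonneg c -> phi (gamma_inf b c) = C0).

(* Main.v *)
(** Canonical compactifiability yields a bound of the sup norm by the square root of the
    energy for finitely supported functions. Minimising the energy of [f - g] over finitely
    supported [g] therefore produces, for every [f] of finite energy, a harmonic [h] such
    that [h - f] tends to zero at infinity; by the maximum principle this extends to the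
    uniform closure [A]. Adjoining constants to [A] gives an algebra stable under Lipschitz
    functions, so every character is a limit of points of [X], and those of the boundary
    are limits along free ultrafilters. Hence elements of [A] that tend to zero at infinity
    are exactly those vanishing on the boundary, which settles uniqueness, and the boundary
    is compact, so that partitions of unity extend every continuous function on it to an
    element of [A] plus the constants. If [c] is not summable, the value of the extension
    at [gamma_inf] is its constant part. *)

Require Import Defs.
From Stdlib Require Import Reals List Classical ClassicalEpsilon FunctionalExtensionality.
From Stdlib Require Import Lra Lia Psatz.
From mathcomp.classical Require filter.
Import ListNotations.
Open Scope R_scope.
Set Bullet Behavior "Strict Subproofs".

(** The energy space is never completed. The sup norm bound makes a minimising sequence converge
    uniformly, so the minimiser is only placed in the uniform closure, and harmonicity survives
    because the Laplacian at a fixed vertex is continuous for the sup norm. The bound itself rests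
    on order: the maximum of two functions has at most the sum of their energies, so a finite
    supremum of functions with summable energies has finite energy. Characters are assumed neither
    continuous nor compatible with conjugation. Both properties follow from one fact: a sum of
    squares killed by a character cannot be bounded away from zero on [X]. No topology is put on the
    boundary; density, compactness and continuity are expressed by elements of the algebra evaluated
    on [X]. The obstacle in the extension is that boundary values do not control the sup norm on
    [X], so each approximate extension carries a bound on all of [X], without which the successive
    corrections need not converge. *)

(** * Finite sums and elementary inequalities *)

Lemma Rabs_le_inv (x y : R) : Rabs x <= y -> - y <= x <= y.
Proof. unfold Rabs; destruct (Rcase_abs x); lra. Qed.

Lemma Rsum_list_ext {T : Type} (f g : T -> R) (l : list T) :
  (forall t, In t l -> f t = g t) -> Rsum_list f l = Rsum_list g l.
Proof.
  induction l as [|a l IH]; intros H; [reflexivity|].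
  simpl. rewrite IH, (H a); auto with datatypes.
Qed.

Lemma Rsum_list_plus {T : Type} (f g : T -> R) (l : list T) :
  Rsum_list (fun t => f t + g t) l = Rsum_list f l + Rsum_list g l.
Proof. induction l as [|a l IH]; simpl; [|rewrite IH]; lra. Qed.

Lemma Rsum_list_scal {T : Type} (k : R) (f : T -> R) (l : list T) :
  Rsum_list (fun t => k * f t) l = k * Rsum_list f l.
Proof. induction l as [|a l IH]; simpl; [|rewrite IH]; lra. Qed.

Lemma Rsum_list_le {T : Type} (f g : T -> R) (l : list T) :
  (forall t, In t l -> f t <= g t) -> Rsum_list f l <= Rsum_list g l.
Proof.
  induction l as [|a l IH]; intros H; simpl; [lra|].
  assert (f a <= g a) by auto with datatypes.
  assert (Rsum_list f l <= Rsum_list g l) by auto with datatypes. lra.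
Qed.

Lemma Rsum_list_nonneg {T : Type} (f : T -> R) (l : list T) :
  (forall t, 0 <= f t) -> 0 <= Rsum_list f l.
Proof. intros H; induction l as [|a l IH]; simpl; [lra|]. specialize (H a); lra. Qed.

Lemma Rsum_list_app {T : Type} (f : T -> R) (l m : list T) :
  Rsum_list f (l ++ m) = Rsum_list f l + Rsum_list f m.
Proof. induction l as [|a l IH]; simpl; [|rewrite IH]; lra. Qed.

Lemma Rsum_list_map {S T : Type} (i : S -> T) (f : T -> R) (l : list S) :
  Rsum_list f (map i l) = Rsum_list (fun s => f (i s)) l.
Proof. induction l as [|a l IH]; simpl; [|rewrite IH]; reflexivity. Qed.

Lemma Rsum_list_incl {T : Type} (f : T -> R) (l m : list T) :
  (forall t, 0 <= f t) -> NoDup l -> incl l m -> Rsum_list f l <= Rsum_list f m.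
Proof.
  intros Hf Hl; revert m; induction Hl as [|a l Ha Hl IH]; intros m Hm.
  - now apply Rsum_list_nonneg.
  - destruct (in_split a m) as [m1 [m2 ->]]; [auto with datatypes|].
    rewrite Rsum_list_app; simpl.
    assert (H : Rsum_list f l <= Rsum_list f (m1 ++ m2)).
    { apply IH. intros t Ht.
      assert (H := Hm t (or_intror Ht)).
      apply in_app_or in H; apply in_or_app.
      destruct H as [H|[H|H]]; auto. subst; contradiction. }
    rewrite Rsum_list_app in H; lra.
Qed.

Lemma nodup_cover {T : Type} (l m : list T) :
  exists k, NoDup k /\ incl l k /\ incl m k.
Proof.
  exists (nodup (fun x y => excluded_middle_informative (x = y)) (l ++ m)).
  split; [apply NoDup_nodup|]; split; intros t Ht; apply nodup_In;
    apply in_or_app; auto.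
Qed.

Lemma choice_fun {A B : Type} (P : A -> B -> Prop) :
  (forall a, exists y, P a y) -> exists f, forall a, P a (f a).
Proof.
  intros H. exists (fun a => proj1_sig (constructive_indefinite_description _ (H a))).
  intros a; apply proj2_sig.
Qed.

(** A difference of maxima is dominated by one of the two differences. Summed over edges, this
    bounds the energy of a maximum by the sum of the energies. *)
Lemma Rmax_diff_sq (a a' p p' : R) :
  (Rmax a p - Rmax a' p') ^ 2 <= (a - a') ^ 2 + (p - p') ^ 2.
Proof.
  assert (H : Rabs (Rmax a p - Rmax a' p') <= Rabs (a - a') \/
    Rabs (Rmax a p - Rmax a' p') <= Rabs (p - p')).
  { unfold Rmax, Rabs. destruct (Rle_dec a p); destruct (Rle_dec a' p');
      repeat destruct Rcase_abs; lra. }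
  assert (H1 := pow2_ge_0 (a - a')). assert (H2 := pow2_ge_0 (p - p')).
  destruct H as [H|H]; apply pow_maj_Rabs with (n := 2%nat) in H;
    rewrite pow2_abs in H; lra.
Qed.

Definition lipschitz (L : R) (Phi : R -> R) : Prop :=
  forall u v, Rabs (Phi u - Phi v) <= L * Rabs (u - v).

(** Truncating at [d] makes the reciprocal globally Lipschitz without changing it on values at least
    [d], so an algebra stable under Lipschitz functions contains the inverses of its elements that
    are bounded below by [d]. *)
Lemma lipschitz_inv_Rmax d : 0 < d -> lipschitz (/ d ^ 2) (fun u => / Rmax d u).
Proof.
  intros Hd u v. set (p := Rmax d u). set (q := Rmax d v).
  assert (Hp : d <= p) by apply Rmax_l. assert (Hq : d <= q) by apply Rmax_l.
  assert (Hpq : Rabs (q - p) <= Rabs (u - v)).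
  { unfold p, q, Rmax; repeat destruct Rle_dec; unfold Rabs;
      repeat destruct Rcase_abs; lra. }
  replace (/ p - / q) with ((q - p) * / (p * q)) by (field; lra).
  assert (Hi : 0 < / (p * q)) by (apply Rinv_0_lt_compat; nra).
  rewrite Rabs_mult, (Rabs_pos_eq (/ (p * q))), Rmult_comm by lra.
  apply Rmult_le_compat; auto; [lra|apply Rabs_pos|].
  apply Rinv_le_contravar; [apply pow_lt; auto|nra].
Qed.

(** The estimate behind partitions of unity: only indices of nonzero weight have to be close to
    [a]. *)
Lemma weighted_sum_close {I : Type} (v h : I -> R) (a e : R) (l : list I) :
  (forall i, 0 <= h i) -> (forall i, In i l -> h i <> 0 -> Rabs (v i - a) <= e) ->
  Rabs (Rsum_list (fun i => v i * h i) l - a * Rsum_list h l) <= e * Rsum_list h l.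
Proof.
  intros Hh; induction l as [|i l IH]; intros Hv; simpl.
  - rewrite !Rmult_0_r, Rminus_diag, Rabs_R0; lra.
  - assert (H1 := IH (fun j Hj => Hv j (or_intror Hj))).
    assert (H2 : Rabs (v i * h i - a * h i) <= e * h i).
    { rewrite <- Rmult_minus_distr_r, Rabs_mult, (Rabs_pos_eq (h i)) by auto.
      destruct (Req_dec (h i) 0) as [->|Hne]; [lra|].
      apply Rmult_le_compat_r; auto. apply Hv; auto; simpl; auto. }
    apply Rabs_le_inv in H1, H2. apply Rabs_le; lra.
Qed.

(** * Unordered real sums *)

Definition has_sum {T : Type} (f : T -> R) (s : R) : Prop :=
  forall eps, 0 < eps -> exists l0 : list T, forall l,
    NoDup l -> incl l0 l -> Rabs (Rsum_list f l - s) < eps.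

Lemma has_sum_unique {T : Type} (f : T -> R) (s s' : R) :
  has_sum f s -> has_sum f s' -> s = s'.
Proof.
  intros H H'. apply cond_eq; intros eps He.
  destruct (H (eps / 2)) as [l1 H1]; [lra|].
  destruct (H' (eps / 2)) as [l2 H2]; [lra|].
  destruct (nodup_cover l1 l2) as [k [Hk [Hk1 Hk2]]].
  specialize (H1 k Hk Hk1); specialize (H2 k Hk Hk2).
  apply Rabs_def2 in H1; apply Rabs_def2 in H2; apply Rabs_def1; lra.
Qed.

Lemma has_sum_ext {T : Type} (f g : T -> R) (s : R) :
  (forall t, f t = g t) -> has_sum f s -> has_sum g s.
Proof. intros H; replace g with f; [auto|now apply functional_extensionality]. Qed.

Lemma has_sum_plus {T : Type} (f g : T -> R) (s s' : R) :
  has_sum f s -> has_sum g s' -> has_sum (fun t => f t + g t) (s + s').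
Proof.
  intros H H' eps He.
  destruct (H (eps / 2)) as [l1 H1]; [lra|].
  destruct (H' (eps / 2)) as [l2 H2]; [lra|].
  exists (l1 ++ l2); intros l Hl Hi; apply incl_app_inv in Hi; destruct Hi as [Hi1 Hi2].
  specialize (H1 l Hl Hi1); specialize (H2 l Hl Hi2).
  rewrite Rsum_list_plus.
  apply Rabs_def2 in H1; apply Rabs_def2 in H2; apply Rabs_def1; lra.
Qed.

Lemma has_sum_scal {T : Type} (k : R) (f : T -> R) (s : R) :
  has_sum f s -> has_sum (fun t => k * f t) (k * s).
Proof.
  intros H eps He.
  assert (Hk := Rabs_pos k).
  destruct (H (eps / (Rabs k + 1))) as [l0 H0]; [apply Rdiv_lt_0_compat; lra|].
  exists l0; intros l Hl Hi; specialize (H0 l Hl Hi).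
  rewrite Rsum_list_scal, <- Rmult_minus_distr_l, Rabs_mult.
  apply (Rmult_lt_compat_r (Rabs k + 1)) in H0; [|lra].
  replace (eps / (Rabs k + 1) * (Rabs k + 1)) with eps in H0 by (field; lra).
  assert (H1 := Rabs_pos (Rsum_list f l - s)). nra.
Qed.

Lemma has_sum_le {T : Type} (f g : T -> R) (s s' : R) :
  (forall t, f t <= g t) -> has_sum f s -> has_sum g s' -> s <= s'.
Proof.
  intros Hfg H H'. apply le_epsilon; intros eps He.
  destruct (H (eps / 2)) as [l1 H1]; [lra|].
  destruct (H' (eps / 2)) as [l2 H2]; [lra|].
  destruct (nodup_cover l1 l2) as [k [Hk [Hk1 Hk2]]].
  specialize (H1 k Hk Hk1); specialize (H2 k Hk Hk2).
  assert (Rsum_list f k <= Rsum_list g k) by (apply Rsum_list_le; auto).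
  apply Rabs_def2 in H1; apply Rabs_def2 in H2; lra.
Qed.

Lemma has_sum_finite_le {T : Type} (f : T -> R) (s : R) (l : list T) :
  (forall t, 0 <= f t) -> has_sum f s -> NoDup l -> Rsum_list f l <= s.
Proof.
  intros Hf H Hl. apply le_epsilon; intros eps He.
  destruct (H eps He) as [l0 H0].
  destruct (nodup_cover l l0) as [k [Hk [Hk1 Hk2]]].
  specialize (H0 k Hk Hk2).
  assert (Rsum_list f l <= Rsum_list f k) by now apply Rsum_list_incl.
  apply Rabs_def2 in H0; lra.
Qed.

Lemma has_sum_term_le {T : Type} (f : T -> R) (s : R) (t : T) :
  (forall t, 0 <= f t) -> has_sum f s -> f t <= s.
Proof.
  intros Hf H. replace (f t) with (Rsum_list f [t]) by (simpl; lra).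
  apply has_sum_finite_le; auto. constructor; [easy|constructor].
Qed.

Lemma has_sum_of_bounded {T : Type} (f : T -> R) (M : R) :
  (forall t, 0 <= f t) -> (forall l, NoDup l -> Rsum_list f l <= M) ->
  exists s, has_sum f s /\ 0 <= s <= M.
Proof.
  intros Hf HM.
  destruct (completeness (fun r => exists l, NoDup l /\ r = Rsum_list f l)) as [s [Hs1 Hs2]].
  - exists M; intros r [l [Hl ->]]; auto.
  - exists 0, []; split; [constructor|reflexivity].
  - exists s; split.
    + intros eps He.
      destruct (classic (exists l, NoDup l /\ s - eps < Rsum_list f l)) as [[l0 [Hl0 H0]]|H].
      * exists l0; intros l Hl Hi.
        assert (Rsum_list f l0 <= Rsum_list f l) by now apply Rsum_list_incl.
        assert (Rsum_list f l <= s) by (apply Hs1; eauto).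
        apply Rabs_def1; lra.
      * exfalso. assert (s <= s - eps); [|lra].
        apply Hs2; intros r [l [Hl ->]].
        apply Rnot_lt_le; intros Hlt; apply H; eauto.
    + split.
      * apply Hs1; exists []; split; [constructor|reflexivity].
      * apply Hs2; intros r [l [Hl ->]]; auto.
Qed.

Lemma summable_has_sum {T : Type} (f : T -> R) :
  (forall t, 0 <= f t) -> summable_nonneg f -> exists s, has_sum f s.
Proof. intros Hf [M HM]. destruct (has_sum_of_bounded f M Hf HM) as [s [Hs _]]; eauto. Qed.

Lemma has_sum_comparison {T : Type} (f g : T -> R) (s : R) :
  (forall t, 0 <= f t <= g t) -> has_sum g s -> exists s', has_sum f s' /\ 0 <= s' <= s.
Proof.
  intros H Hg. apply has_sum_of_bounded; [apply H|].
  intros l Hl. transitivity (Rsum_list g l).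
  - apply Rsum_list_le; intros; apply H.
  - apply has_sum_finite_le; auto. intros t; specialize (H t); lra.
Qed.

(** Adding [g] reduces to a nonnegative family bounded by [2 * g]. *)
Lemma has_sum_dominated {T : Type} (f g : T -> R) (s : R) :
  (forall t, Rabs (f t) <= g t) -> has_sum g s -> exists s', has_sum f s'.
Proof.
  intros H Hg.
  assert (H' : forall t, 0 <= f t + g t <= 2 * g t).
  { intros t; specialize (H t); apply Rabs_le_inv in H; lra. }
  destruct (has_sum_comparison _ _ _ H' (has_sum_scal 2 _ _ Hg)) as [s' [Hs' _]].
  exists (s' + -1 * s).
  eapply has_sum_ext; [|apply has_sum_plus; [exact Hs'|apply has_sum_scal, Hg]].
  intros t; simpl; lra.
Qed.

Lemma Rsum_list_preimage {S T : Type} (i : S -> T) (f : T -> R) (l : list T) :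
  (forall x y, i x = i y -> x = y) -> (forall t, (forall s, i s <> t) -> f t = 0) ->
  NoDup l ->
  exists k, NoDup k /\ Rsum_list f l = Rsum_list (fun s => f (i s)) k /\
    forall s, In s k <-> In (i s) l.
Proof.
  intros Hi Hf Hl; induction Hl as [|a l Ha Hl [k [Hk [He Hin]]]].
  - exists []; split; [constructor|split; [reflexivity|easy]].
  - destruct (classic (exists s, i s = a)) as [[s <-]|Hn].
    + exists (s :: k); split; [|split].
      * constructor; auto. intros H; apply Ha, Hin, H.
      * simpl; rewrite He; reflexivity.
      * intros s'; simpl; rewrite Hin; split; intros [H|H]; subst; auto.
    + exists k; split; [auto|split].
      * simpl; rewrite Hf, He by (intros s Hs; eauto); lra.
      * intros s; rewrite Hin; simpl; split; auto.
        intros [H|H]; auto. exfalso; eauto.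
Qed.

(** Extends a family by zero along an injection; this is how sums over edges or over vertices enter
    the energy, which is indexed by a disjoint union. *)
Lemma has_sum_inj {S T : Type} (i : S -> T) (f : T -> R) (s : R) :
  (forall x y, i x = i y -> x = y) -> (forall t, (forall s, i s <> t) -> f t = 0) ->
  has_sum (fun s => f (i s)) s -> has_sum f s.
Proof.
  intros Hi Hf H eps He. destruct (H eps He) as [l0 H0].
  exists (map i l0); intros l Hl Hil.
  destruct (Rsum_list_preimage i f l Hi Hf Hl) as [k [Hk [-> Hin]]].
  apply H0; auto. intros t Ht; apply Hin, Hil; now apply in_map.
Qed.

(** * Limits of sequences and uniform limits *)

Lemma Un_cv_Rsum_list {T : Type} (f : nat -> T -> R) (g : T -> R) (l : list T) :
  (forall t, Un_cv (fun n => f n t) (g t)) ->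
  Un_cv (fun n => Rsum_list (f n) l) (Rsum_list g l).
Proof.
  intros H; induction l as [|a l IH]; simpl.
  - intros eps He; exists 0%nat; intros n _; rewrite Rdist_eq; auto.
  - now apply CV_plus.
Qed.

Lemma Un_cv_le_const (u : nat -> R) (l M : R) :
  Un_cv u l -> (forall n, u n <= M) -> l <= M.
Proof.
  intros H HM. apply le_epsilon; intros eps He.
  destruct (H eps He) as [N HN]. specialize (HN N (Nat.le_refl _)).
  unfold Rdist in HN; apply Rabs_def2 in HN. specialize (HM N); lra.
Qed.

Lemma inv_INR_cv (eps : R) : 0 < eps -> exists N, 0 < / (INR N + 1) < eps.
Proof.
  intros He. destruct (archimed_cor1 eps He) as [N [H1 H2]].
  exists N. assert (0 < INR N) by (apply lt_0_INR; lia).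
  split; [apply Rinv_0_lt_compat; lra|].
  apply Rlt_trans with (/ INR N); auto. apply Rinv_lt_contravar; nra.
Qed.

Lemma inv_INR_eventually (eps : R) :
  0 < eps -> exists N, forall n, (N <= n)%nat -> / (INR n + 1) < eps.
Proof.
  intros He. destruct (inv_INR_cv eps He) as [N [HN0 HN]]. exists N; intros n Hn.
  apply le_INR in Hn. apply Rle_lt_trans with (2 := HN).
  assert (0 <= INR N) by apply pos_INR. apply Rinv_le_contravar; lra.
Qed.

Lemma half_pow_eventually (eps : R) :
  0 < eps -> exists N, forall n, (N <= n)%nat -> 2 * (/ 2) ^ n < eps.
Proof.
  intros He. destruct (pow_lt_1_zero (/ 2)) with (y := eps / 2) as [N HN]; [|lra|].
  - rewrite Rabs_pos_eq; lra.
  - exists N; intros n Hn. specialize (HN n Hn).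
    rewrite Rabs_pos_eq in HN; [lra|]. apply pow_le; lra.
Qed.

(** With the error split as [e n + e m], letting [m] grow removes [e m] and leaves exactly [e n] for
    the limit. No sign or monotonicity of [e] enters. *)
Lemma uniform_limit {X : Type} (g : nat -> X -> R) (e : nat -> R) :
  (forall eps, 0 < eps -> exists N, forall n, (N <= n)%nat -> e n < eps) ->
  (forall n m x, Rabs (g n x - g m x) <= e n + e m) ->
  exists h, forall n x, Rabs (h x - g n x) <= e n.
Proof.
  intros He Hg.
  assert (H : forall x, exists l, Un_cv (fun n => g n x) l).
  { intros x. destruct (R_complete (fun n => g n x)) as [l Hl]; [|eauto].
    intros eps Heps. destruct (He (eps / 2)) as [N HN]; [lra|].
    exists N; intros n m Hn Hm. unfold Rdist.
    apply Rle_lt_trans with (1 := Hg n m x).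
    specialize (HN n Hn) as H1; specialize (HN m Hm) as H2; lra. }
  exists (fun x => epsilon (inhabits 0) (fun l => Un_cv (fun n => g n x) l)).
  intros n x. assert (Hl := epsilon_spec (inhabits 0) _ (H x)); simpl in Hl.
  set (l := epsilon _ _) in *; clearbody l.
  apply le_epsilon; intros eps Heps.
  destruct (He (eps / 2)) as [N1 HN1]; [lra|].
  destruct (Hl (eps / 2)) as [N2 HN2]; [lra|].
  specialize (HN1 (max N1 N2) (Nat.le_max_l _ _)).
  specialize (HN2 (max N1 N2) (Nat.le_max_r _ _)). unfold Rdist in HN2.
  specialize (Hg (max N1 N2) n x).
  apply Rabs_le_inv in Hg; apply Rabs_def2 in HN2; apply Rabs_le; lra.
Qed.

(** * Ultrafilters *)

Definition ultrafilter {T : Type} (U : (T -> Prop) -> Prop) : Prop :=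
  (forall A B : T -> Prop, (forall x, A x -> B x) -> U A -> U B) /\
  (forall A B : T -> Prop, U A -> U B -> U (fun x => A x /\ B x)) /\
  ~ U (fun _ => False) /\
  (forall A : T -> Prop, U A \/ U (fun x => ~ A x)).

(** Finite intersections of members of [P] generate a proper filter, which the ultrafilter lemma
    extends. Intersections are given by lists, so that the hypothesis is the finite intersection
    property. *)
Lemma ultrafilter_exists {T : Type} (P : (T -> Prop) -> Prop) :
  (forall l, (forall A, In A l -> P A) -> exists x, forall A, In A l -> A x) ->
  exists U, ultrafilter U /\ forall A, P A -> U A.
Proof.
  intros HP.
  set (F := fun A : T -> Prop => exists l, (forall B, In B l -> P B) /\
    forall x, (forall B, In B l -> B x) -> A x).
  assert (HF : filter.ProperFilter F).
  { constructor; [|constructor].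
    - intros [l [Hl Hx]]. destruct (HP l Hl) as [x H]. exact (Hx x H).
    - exists []; split; [easy|]. intros; exact I.
    - intros A B [l [Hl Hx]] [l' [Hl' Hx']]. exists (l ++ l'); split.
      + intros C HC; apply in_app_or in HC; destruct HC; auto.
      + intros x H; split; [apply Hx|apply Hx']; intros C HC; apply H, in_or_app; auto.
    - intros A B HAB [l [Hl Hx]]. exists l; split; auto. }
  destruct (filter.ultraFilterLemma HF) as [U [HU HFU]].
  exists U; split; [split; [|split; [|split]]|].
  - intros A B HAB HA. exact (filter.filterS HAB HA).
  - intros A B HA HB. exact (filter.filterI HA HB).
  - intros H. exact (filter.filter_not_empty U H).
  - intros A. exact (filter.in_ultra_setVsetC A HU).
  - intros A HA. apply HFU. exists [A]; split.
    + intros B [<-|[]]; auto.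
    + intros x H; apply H; simpl; auto.
Qed.

Definition ulim {T : Type} (U : (T -> Prop) -> Prop) (f : T -> R) (a : R) : Prop :=
  forall eps, 0 < eps -> U (fun x => Rabs (f x - a) < eps).

Section UltrafilterLimits.

Context {T : Type} (U : (T -> Prop) -> Prop) (HU : ultrafilter U).

Lemma ultrafilter_inhabited A : U A -> exists x, A x.
Proof.
  intros HA. apply NNPP; intros Hn. destruct HU as [HS [_ [H0 _]]].
  apply H0. apply HS with (2 := HA). intros x Hx; eauto.
Qed.

Lemma ulim_exists (f : T -> R) (M : R) : (forall x, Rabs (f x) <= M) -> exists a, ulim U f a.
Proof.
  intros HM. destruct HU as [HS [HI [H0 HC]]].
  assert (HT : U (fun _ => True)).
  { destruct (HC (fun _ => True)) as [H|H]; auto. exfalso; apply H0.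
    apply HS with (2 := H); tauto. }
  (* The limit is the supremum of the levels that [f] reaches on a set of [U]. *)
  destruct (completeness (fun r => U (fun x => r <= f x))) as [a [Ha1 Ha2]].
  - exists M; intros r Hr. destruct (ultrafilter_inhabited _ Hr) as [x Hx].
    specialize (HM x); apply Rabs_le_inv in HM; lra.
  - exists (- M). apply HS with (2 := HT). intros x _.
    specialize (HM x); apply Rabs_le_inv in HM; lra.
  - exists a; intros eps He.
    assert (H1 : exists r, U (fun x => r <= f x) /\ a - eps < r).
    { apply NNPP; intros Hn. assert (a <= a - eps); [|lra].
      apply Ha2; intros r Hr. apply Rnot_lt_le; eauto. }
    destruct H1 as [r [Hr Har]].
    destruct (HC (fun x => a + eps / 2 <= f x)) as [H|H].
    + apply Ha1 in H; lra.
    + apply HS with (2 := HI _ _ Hr H). intros x [Hx1 Hx2].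
      apply Rnot_le_lt in Hx2. apply Rabs_def1; lra.
Qed.

Lemma ulim_unique f a a' : ulim U f a -> ulim U f a' -> a = a'.
Proof.
  intros H H'. apply cond_eq; intros eps He. destruct HU as [_ [HI _]].
  destruct (ultrafilter_inhabited _ (HI _ _ (H (eps / 2) ltac:(lra)) (H' (eps / 2) ltac:(lra))))
    as [x [H1 H2]].
  apply Rabs_def2 in H1, H2. apply Rabs_def1; lra.
Qed.

Lemma ulim_plus f g a a' :
  ulim U f a -> ulim U g a' -> ulim U (fun x => f x + g x) (a + a').
Proof.
  intros H H' eps He. destruct HU as [HS [HI _]].
  apply HS with (2 := HI _ _ (H (eps / 2) ltac:(lra)) (H' (eps / 2) ltac:(lra))).
  intros x [H1 H2]. apply Rabs_def2 in H1, H2. apply Rabs_def1; lra.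
Qed.

Lemma ulim_eventually_eq f a : U (fun x => f x = a) -> ulim U f a.
Proof.
  intros H eps He. destruct HU as [HS _]. apply HS with (2 := H).
  intros x ->. now rewrite Rminus_diag, Rabs_R0.
Qed.

Lemma ulim_mult f g a a' :
  ulim U f a -> ulim U g a' -> ulim U (fun x => f x * g x) (a * a').
Proof.
  intros H H' eps He. destruct HU as [HS [HI _]].
  (* As [d <= 1], the three error terms [d * d], [Rabs a * d] and [Rabs a' * d] add up to at most
     [d * K]. *)
  set (K := 1 + Rabs a + Rabs a').
  assert (HK : 1 <= K)
    by (unfold K; assert (H1 := Rabs_pos a); assert (H2 := Rabs_pos a'); lra).
  set (d := Rmin 1 (eps / (2 * K))).
  assert (Hd : 0 < d) by (apply Rmin_glb_lt; [lra|apply Rdiv_lt_0_compat; lra]).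
  assert (Hd1 : d <= 1) by apply Rmin_l.
  assert (Hd2 : d * K <= eps / 2).
  { replace (eps / 2) with (eps / (2 * K) * K) by (field; lra).
    apply Rmult_le_compat_r; [lra|apply Rmin_r]. }
  apply HS with (2 := HI _ _ (H d Hd) (H' d Hd)). intros x [H1 H2].
  replace (f x * g x - a * a')
    with ((f x - a) * (g x - a') + (a * (g x - a') + a' * (f x - a))) by ring.
  apply Rle_lt_trans with (1 := Rabs_triang _ _).
  assert (H3 := Rabs_triang (a * (g x - a')) (a' * (f x - a))).
  rewrite !Rabs_mult in *.
  assert (P1 := Rabs_pos (f x - a)); assert (P2 := Rabs_pos (g x - a')).
  assert (P3 := Rabs_pos a); assert (P4 := Rabs_pos a'). unfold K in *. nra.
Qed.

Lemma ulim_const a : ulim U (fun _ => a) a.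
Proof.
  apply ulim_eventually_eq. destruct HU as [HS [_ [H0 HC]]].
  destruct (HC (fun _ => a = a)) as [H|H]; auto.
  exfalso; apply H0. apply HS with (2 := H). auto.
Qed.

End UltrafilterLimits.

(** * Complex numbers *)

Lemma Cmod_sq z : Cmod z ^ 2 = re z ^ 2 + im z ^ 2.
Proof.
  unfold Cmod. rewrite <- Rsqr_pow2, Rsqr_sqrt; [ring|nra].
Qed.

Lemma Cmod_nonneg z : 0 <= Cmod z.
Proof. apply sqrt_pos. Qed.

Lemma Cmod_le_iff z r : 0 <= r -> (Cmod z <= r <-> re z ^ 2 + im z ^ 2 <= r ^ 2).
Proof.
  intros Hr; rewrite <- Cmod_sq; assert (H := Cmod_nonneg z); split; intros; nra.
Qed.

Lemma Rabs_re_le z : Rabs (re z) <= Cmod z.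
Proof.
  assert (H := Cmod_sq z); assert (H' := Cmod_nonneg z). apply Rabs_le; split; nra.
Qed.

Lemma Rabs_im_le z : Rabs (im z) <= Cmod z.
Proof.
  assert (H := Cmod_sq z); assert (H' := Cmod_nonneg z). apply Rabs_le; split; nra.
Qed.

Lemma Cmod_le_abs z : Cmod z <= Rabs (re z) + Rabs (im z).
Proof.
  assert (H := Rabs_pos (re z)); assert (H' := Rabs_pos (im z)).
  apply Cmod_le_iff; [lra|].
  rewrite <- (pow2_abs (re z)), <- (pow2_abs (im z)). nra.
Qed.

Lemma Cmod_RtoC r : Cmod (RtoC r) = Rabs r.
Proof.
  unfold Cmod, RtoC; simpl. rewrite <- sqrt_Rsqr_abs; f_equal; unfold Rsqr; ring.
Qed.

Lemma Cplx_eq (z w : Cplx) : re z = re w -> im z = im w -> z = w.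
Proof. destruct z, w; simpl; congruence. Qed.

Lemma Cmul_fixed_eq_one z w : z <> C0 -> z = Cmul z w -> w = Defs.C1.
Proof.
  destruct z as [p q], w as [u v]. unfold Cmul, C0, Defs.C1; simpl.
  intros Hz E. injection E as E1 E2.
  assert (Hpos : 0 < p ^ 2 + q ^ 2).
  { assert (Hne : p <> 0 \/ q <> 0).
    { apply not_and_or; intros [-> ->]; auto. }
    destruct Hne as [H|H]; apply pow_nonzero with (n := 2%nat) in H; nra. }
  assert (F1 : (p ^ 2 + q ^ 2) * (u - 1) = 0).
  { replace ((p ^ 2 + q ^ 2) * (u - 1))
      with (p * (p * u - q * v - p) + q * (p * v + q * u - q)) by ring.
    rewrite <- E1, <- E2; ring. }
  assert (F2 : (p ^ 2 + q ^ 2) * v = 0).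
  { replace ((p ^ 2 + q ^ 2) * v)
      with (p * (p * v + q * u - q) - q * (p * u - q * v - p)) by ring.
    rewrite <- E1, <- E2; ring. }
  apply Rmult_integral in F1, F2.
  f_equal; destruct F1, F2; lra.
Qed.

(** [Ctsum] is a choice among possible sums, so its value is only accessible through existence and
    uniqueness of the two real sums. *)
Lemma C_has_sum_Ctsum {T : Type} (f : T -> Cplx) p q :
  has_sum (fun t => re (f t)) p -> has_sum (fun t => im (f t)) q -> Ctsum f = mkC p q.
Proof.
  intros Hp Hq.
  assert (E : forall l, Csum_list f l
    = mkC (Rsum_list (fun t => re (f t)) l) (Rsum_list (fun t => im (f t)) l)).
  { induction l as [|t l IH]; simpl; [reflexivity|]. rewrite IH; reflexivity. }
  assert (H : C_has_sum f (mkC p q)).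
  { intros eps He. destruct (Hp (eps / 2)) as [l1 H1]; [lra|].
    destruct (Hq (eps / 2)) as [l2 H2]; [lra|].
    exists (l1 ++ l2); intros l Hl Hi. apply incl_app_inv in Hi. destruct Hi as [Hi1 Hi2].
    specialize (H1 l Hl Hi1); specialize (H2 l Hl Hi2).
    apply Rle_lt_trans with (1 := Cmod_le_abs _). rewrite E.
    change (Rabs (Rsum_list (fun t => re (f t)) l - p)
      + Rabs (Rsum_list (fun t => im (f t)) l - q) < eps). lra. }
  assert (H' : C_has_sum f (Ctsum f)) 
    by exact (epsilon_spec (inhabits C0) (fun s => C_has_sum f s) (ex_intro _ _ H)).
  apply Cplx_eq.
  - apply (has_sum_unique (fun t => re (f t))); auto.
    intros eps He. destruct (H' eps He) as [l0 H0]. exists l0; intros l Hl Hi.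
    specialize (H0 l Hl Hi). rewrite E in H0.
    exact (Rle_lt_trans _ _ _ (Rabs_re_le _) H0).
  - apply (has_sum_unique (fun t => im (f t))); auto.
    intros eps He. destruct (H' eps He) as [l0 H0]. exists l0; intros l Hl Hi.
    specialize (H0 l Hl Hi). rewrite E in H0.
    exact (Rle_lt_trans _ _ _ (Rabs_im_le _) H0).
Qed.

(** * Finite energy functions *)

Section Graph.

Context {X : Type} (b : X -> X -> R) (c : X -> R).
Context (HX : countably_infinite X) (Hg : weighted_graph b c) (Hconn : connected b)
  (Hcc : canonically_compactifiable b c).

(** [X] is infinite, so no list exhausts it. Applied to the empty list, it also supplies a
    vertex. *)
Lemma fresh_vertex (l : list X) : exists x, ~ In x l.
Proof.
  apply NNPP; intros H. destruct HX as [e [He _]].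
  assert (Hl : (length (map e (seq 0 (S (length l)))) <= length l)%nat).
  { apply NoDup_incl_length.
    - apply NoDup_map_NoDup_ForallPairs; [|apply seq_NoDup].
      intros x y _ _; apply He.
    - intros x _; apply NNPP; intros Hx; eauto. }
  rewrite length_map, length_seq in Hl; lia.
Qed.

(** Connectedness as an induction principle: it suffices to propagate a property along edges. *)
Lemma connected_ind (P : X -> Prop) (o : X) :
  P o -> (forall x y, 0 < b x y -> P x -> P y) -> forall x, P x.
Proof.
  intros Ho Hstep x. destruct (classic (o = x)) as [<-|Hne]; auto.
  destruct (Hconn o x Hne) as [l [_ Hl]].
  clear Hne; revert o Ho Hl; induction l as [|a l IH]; simpl; intros o Ho Hl.
  - destruct Hl; eauto.
  - destruct Hl as [H1 H2]. apply (IH a); eauto.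
Qed.

(* The energy is a sum over ordered pairs and vertices; each edge occurs as two pairs,
   whence the factor 1/2. *)
Definition wt (t : X * X + X) : R :=
  match t with inl (x, y) => b x y / 2 | inr x => c x end.

(** At a vertex, [c] acts as the weight of an edge to an extra point where every function is
    zero. *)
Definition diff (f : X -> R) (t : X * X + X) : R :=
  match t with inl (x, y) => f x - f y | inr x => f x end.

Definition energy (f : X -> R) (s : R) : Prop :=
  has_sum (fun t => wt t * diff f t ^ 2) s.

Definition finite_energy (f : X -> R) : Prop := exists s, energy f s.

(** A relation, since the sum may fail to exist. The killing term is moved to the value so that only
    the sum over neighbours remains. *)
Definition laplacian (f : X -> R) (x : X) (s : R) : Prop :=
  has_sum (fun y => b x y * (f x - f y)) (s - c x * f x).

Definition indicator (x y : X) : R :=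
  if excluded_middle_informative (y = x) then 1 else 0.

Definition finite_support (f : X -> R) : Prop :=
  exists l, forall x, ~ In x l -> f x = 0.

Lemma indicator_eq x : indicator x x = 1.
Proof. unfold indicator; destruct excluded_middle_informative; congruence. Qed.

Lemma indicator_neq x y : y <> x -> indicator x y = 0.
Proof. unfold indicator; destruct excluded_middle_informative; congruence. Qed.

Lemma wt_nonneg t : 0 <= wt t.
Proof.
  destruct Hg as [Hb [_ [_ [_ Hc]]]].
  destruct t as [[x y]|x]; simpl; [specialize (Hb x y); lra|apply Hc].
Qed.

Lemma diff_plus f g t : diff (fun x => f x + g x) t = diff f t + diff g t.
Proof. destruct t as [[x y]|x]; simpl; lra. Qed.

Lemma diff_scal k f t : diff (fun x => k * f x) t = k * diff f t.
Proof. destruct t as [[x y]|x]; simpl; lra. Qed.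

Lemma energy_term_nonneg f t : 0 <= wt t * diff f t ^ 2.
Proof. assert (H := wt_nonneg t). nra. Qed.

Lemma energy_term_le f s t : energy f s -> wt t * diff f t ^ 2 <= s.
Proof.
  intros H. apply (has_sum_term_le (fun t => wt t * diff f t ^ 2)); auto.
  apply energy_term_nonneg.
Qed.

Lemma energy_nonneg f s : energy f s -> 0 <= s.
Proof.
  intros H. destruct (fresh_vertex []) as [o _].
  apply Rle_trans with (2 := energy_term_le f s (inr o) H), energy_term_nonneg.
Qed.

Lemma energy_contraction f g s :
  (forall t, wt t * diff f t ^ 2 <= wt t * diff g t ^ 2) -> energy g s ->
  exists s', energy f s' /\ 0 <= s' <= s.
Proof.
  intros H Hs. apply has_sum_comparison with (2 := Hs).
  intros t; split; [apply energy_term_nonneg|apply H].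
Qed.

Lemma energy_scal k f s : energy f s -> energy (fun x => k * f x) (k ^ 2 * s).
Proof.
  intros H. eapply has_sum_ext; [|apply (has_sum_scal (k ^ 2)), H].
  intros t; simpl; rewrite diff_scal; ring.
Qed.

Lemma finite_energy_scal k f : finite_energy f -> finite_energy (fun x => k * f x).
Proof. intros [s Hs]; eexists; apply energy_scal, Hs. Qed.

Lemma finite_energy_comparison f G s :
  (forall t, wt t * diff f t ^ 2 <= G t) -> has_sum G s -> finite_energy f.
Proof.
  intros H Hs. destruct (has_sum_comparison (fun t => wt t * diff f t ^ 2) G s)
    as [r [Hr _]]; [|auto|now exists r].
  intros t; split; [apply energy_term_nonneg|apply H].
Qed.

Lemma finite_energy_plus f g :
  finite_energy f -> finite_energy g -> finite_energy (fun x => f x + g x).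
Proof.
  intros [s Hs] [s' Hs'].
  eapply finite_energy_comparison;
    [|exact (has_sum_scal 2 _ _ (has_sum_plus _ _ _ _ Hs Hs'))].
  intros t; simpl. rewrite diff_plus. assert (H := wt_nonneg t).
  assert (H1 := pow2_ge_0 (diff f t - diff g t)). nra.
Qed.

(** Turns near minimality of two functions into a small energy of their difference. *)
Lemma energy_parallelogram f g s s' p q :
  energy f s -> energy g s' -> energy (fun x => f x + g x) p ->
  energy (fun x => f x - g x) q -> p + q = 2 * s + 2 * s'.
Proof.
  intros Hs Hs' Hp Hq.
  apply (has_sum_unique (fun t => wt t * diff (fun x => f x + g x) t ^ 2
    + wt t * diff (fun x => f x - g x) t ^ 2)); [now apply has_sum_plus|].
  eapply has_sum_ext;
    [|apply has_sum_plus; [apply (has_sum_scal 2), Hs|apply (has_sum_scal 2), Hs']].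
  intros [[x y]|x]; simpl; ring.
Qed.

Lemma laplacian_exists f x M :
  (forall y, Rabs (f y) <= M) -> exists s, laplacian f x s.
Proof.
  intros HM. destruct Hg as [Hb [_ [_ [Hs _]]]].
  destruct (summable_has_sum (b x) (Hb x) (Hs x)) as [B HB].
  destruct (has_sum_dominated (fun y => b x y * (f x - f y)) (fun y => 2 * M * b x y)
    (2 * M * B)) as [s Hs'].
  - intros y. rewrite Rabs_mult, (Rabs_pos_eq (b x y)) by auto.
    assert (H1 := Rabs_le_inv _ _ (HM x)); assert (H2 := Rabs_le_inv _ _ (HM y)).
    assert (Rabs (f x - f y) <= 2 * M) by (apply Rabs_le; lra).
    specialize (Hb x y); nra.
  - now apply has_sum_scal.
  - exists (s + c x * f x). unfold laplacian.
    now replace (s + c x * f x - c x * f x) with s by ring.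
Qed.

Lemma laplacian_plus f g x s s' :
  laplacian f x s -> laplacian g x s' -> laplacian (fun y => f y + g y) x (s + s').
Proof.
  intros H H'. unfold laplacian.
  replace (s + s' - c x * (f x + g x)) with ((s - c x * f x) + (s' - c x * g x)) by ring.
  eapply has_sum_ext; [|exact (has_sum_plus _ _ _ _ H H')]. intros y; simpl; ring.
Qed.

Lemma laplacian_scal k f x s :
  laplacian f x s -> laplacian (fun y => k * f y) x (k * s).
Proof.
  intros H. unfold laplacian.
  replace (k * s - c x * (k * f x)) with (k * (s - c x * f x)) by ring.
  eapply has_sum_ext; [|exact (has_sum_scal k _ _ H)]. intros y; simpl; ring.
Qed.

Lemma laplacian_minus f g x s s' :
  laplacian f x s -> laplacian g x s' -> laplacian (fun y => f y - g y) x (s - s').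
Proof.
  intros H H'. replace (fun y => f y - g y) with (fun y => f y + -1 * g y)
    by (apply functional_extensionality; intros y; ring).
  replace (s - s') with (s + -1 * s') by ring.
  now apply laplacian_plus, laplacian_scal.
Qed.

(** Green's formula tested against the indicator of [x]. The nonzero terms come from pairs starting
    at [x] ([G1]), pairs ending at [x] ([G2]) and the vertex [x] itself ([G3]); by symmetry of [b]
    the first two families each give half of the edge part. *)
Lemma energy_pairing_indicator f x s :
  laplacian f x s -> has_sum (fun t => wt t * (diff f t * diff (indicator x) t)) s.
Proof.
  intros H. destruct Hg as [_ [Hsym [Hdiag _]]].
  set (dec := fun p q : X => excluded_middle_informative (p = q)).
  set (G1 := fun t : X * X + X => match t with
    | inl (p, q) => if dec p x then b x q / 2 * (f x - f q) else 0 | inr _ => 0 end).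
  set (G2 := fun t : X * X + X => match t with
    | inl (p, q) => if dec q x then b x p / 2 * (f x - f p) else 0 | inr _ => 0 end).
  set (G3 := fun t : X * X + X => match t with
    | inl _ => 0 | inr p => if dec p x then c x * f x else 0 end).
  assert (Hhalf : has_sum (fun y => b x y / 2 * (f x - f y)) (/ 2 * (s - c x * f x))).
  { eapply has_sum_ext; [|exact (has_sum_scal (/ 2) _ _ H)]. intros y; simpl; field. }
  assert (H1 : has_sum G1 (/ 2 * (s - c x * f x))).
  { apply (has_sum_inj (fun y => inl (x, y))).
    - congruence.
    - intros [[p q]|p] Hp; simpl; auto. destruct (dec p x) as [->|]; auto.
      now destruct (Hp q).
    - eapply has_sum_ext; [|exact Hhalf]. intros y; simpl.
      destruct (dec x x); congruence. }
  assert (H2 : has_sum G2 (/ 2 * (s - c x * f x))).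
  { apply (has_sum_inj (fun y => inl (y, x))).
    - congruence.
    - intros [[p q]|p] Hp; simpl; auto. destruct (dec q x) as [->|]; auto.
      now destruct (Hp p).
    - eapply has_sum_ext; [|exact Hhalf]. intros y; simpl.
      destruct (dec x x); congruence. }
  assert (H3 : has_sum G3 (c x * f x)).
  { apply (has_sum_inj (fun _ : unit => inr x)).
    - now intros [] [].
    - intros [[p q]|p] Hp; simpl; auto. destruct (dec p x) as [->|]; auto.
      now destruct (Hp tt).
    - intros eps He; exists [tt]; intros l Hl Hi.
      replace l with [tt].
      + simpl. destruct (dec x x); [|congruence].
        rewrite Rplus_0_r, Rminus_diag, Rabs_R0; auto.
      + destruct l as [|[] [|[] l]]; auto.
        * now destruct (Hi tt (or_introl eq_refl)).
        * inversion Hl; exfalso; simpl in *; auto. }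
  replace s with ((/ 2 * (s - c x * f x) + / 2 * (s - c x * f x)) + c x * f x) by lra.
  eapply has_sum_ext; [|exact (has_sum_plus _ _ _ _ (has_sum_plus _ _ _ _ H1 H2) H3)].
  intros [[p q]|p]; simpl; unfold indicator, dec.
  - destruct (excluded_middle_informative (p = x)) as [->|];
      destruct (excluded_middle_informative (q = x)) as [->|];
      rewrite ?Hdiag, ?(Hsym p x); lra.
  - destruct (excluded_middle_informative (p = x)) as [->|]; lra.
Qed.

Lemma laplacian_indicator_exists x : exists D, laplacian (indicator x) x D.
Proof.
  apply laplacian_exists with (M := 1). intros y; unfold indicator.
  destruct excluded_middle_informative; rewrite ?Rabs_R1, ?Rabs_R0; lra.
Qed.

Lemma energy_indicator x D : laplacian (indicator x) x D -> energy (indicator x) D.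
Proof.
  intros H. eapply has_sum_ext; [|exact (energy_pairing_indicator _ _ _ H)].
  intros t; simpl; ring.
Qed.

(** The energy along the line through [f] in direction [indicator x] is a quadratic polynomial in
    [k] whose linear coefficient is twice the Laplacian at [x]; [D] is both the Laplacian and the
    energy of the indicator. *)
Lemma energy_perturbation f x r s D k :
  energy f r -> laplacian f x s -> laplacian (indicator x) x D ->
  energy (fun y => f y + k * indicator x y) (r + 2 * k * s + k ^ 2 * D).
Proof.
  intros Hr Hs HD.
  assert (Hp := energy_pairing_indicator _ _ _ Hs).
  assert (Hi := energy_indicator _ _ HD).
  eapply has_sum_ext; [|exact (has_sum_plus _ _ _ _
    (has_sum_plus _ _ _ _ Hr (has_sum_scal (2 * k) _ _ Hp)) (has_sum_scal (k ^ 2) _ _ Hi))].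
  intros t; simpl. rewrite diff_plus, diff_scal. ring.
Qed.

Lemma finite_support_scal k f : finite_support f -> finite_support (fun x => k * f x).
Proof. intros [l H]; exists l; intros x Hx; rewrite H; auto; ring. Qed.

Lemma finite_support_plus f g :
  finite_support f -> finite_support g -> finite_support (fun x => f x + g x).
Proof.
  intros [l H] [l' H']; exists (l ++ l'); intros x Hx.
  rewrite H, H'; [ring| |]; intros Hi; apply Hx, in_or_app; auto.
Qed.

Lemma finite_support_indicator x : finite_support (indicator x).
Proof.
  exists [x]; intros y Hy; apply indicator_neq; intros ->; apply Hy; simpl; auto.
Qed.

Lemma finite_support_energy f : finite_support f -> finite_energy f.
Proof.
  intros [l Hl]; revert f Hl; induction l as [|a l IH]; intros f Hl.
  - exists 0. intros eps He; exists []; intros l _ _.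
    rewrite (Rsum_list_ext _ (fun t => 0 * wt t)), Rsum_list_scal.
    + now rewrite Rmult_0_l, Rminus_diag, Rabs_R0.
    + intros [[x y]|x] _; simpl; rewrite !Hl by easy; ring.
  - replace f with (fun x => (f x + - f a * indicator a x) + f a * indicator a x)
      by (apply functional_extensionality; intros x; ring).
    apply finite_energy_plus.
    + apply IH. intros x Hx. destruct (classic (x = a)) as [->|Hne].
      * rewrite indicator_eq; ring.
      * rewrite indicator_neq by auto. rewrite Hl; [ring|].
        intros [H|H]; congruence.
    + apply finite_energy_scal. destruct (laplacian_indicator_exists a) as [D HD].
      exists D; now apply energy_indicator.
Qed.

(** Both directions are termwise comparisons, since the squared modulus is the sum of the squares of
    the two parts. The factor 1/2 on edges does not affect finiteness. *)
Lemma Qfinite_iff (f : X -> Cplx) :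
  Qfinite b c f <-> finite_energy (fun x => re (f x)) /\ finite_energy (fun x => im (f x)).
Proof.
  assert (Hb : forall x y, 0 <= b x y) by apply Hg.
  assert (Hc : forall x, 0 <= c x) by apply Hg.
  split.
  - intros [H1 H2].
    apply summable_has_sum in H1; [|intros t; apply Rmult_le_pos; auto; apply pow2_ge_0].
    apply summable_has_sum in H2; [|intros t; apply Rmult_le_pos; auto; apply pow2_ge_0].
    destruct H1 as [s1 H1], H2 as [s2 H2].
    set (G1 := fun t : X * X + X => match t with
      | inl (x, y) => b x y * Cmod (Csub (f x) (f y)) ^ 2 | inr _ => 0 end).
    set (G2 := fun t : X * X + X => match t with
      | inl _ => 0 | inr x => c x * Cmod (f x) ^ 2 end).
    assert (K1 : has_sum G1 s1).
    { apply (has_sum_inj inl).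
      - congruence.
      - intros [[x y]|x] H; auto. now destruct (H (x, y)).
      - eapply has_sum_ext; [|exact H1]. now intros [x y]. }
    assert (K2 : has_sum G2 s2).
    { apply (has_sum_inj inr).
      - congruence.
      - intros [[x y]|x] H; auto. now destruct (H x).
      - eapply has_sum_ext; [|exact H2]. now intros x. }
    assert (K := has_sum_plus _ _ _ _ K1 K2).
    split.
    + apply finite_energy_comparison with (2 := K).
      intros [[x y]|x]; simpl wt; simpl diff; unfold G1, G2; rewrite Cmod_sq; simpl.
      * specialize (Hb x y). assert (H3 := pow2_ge_0 (re (f x) - re (f y))).
        assert (H4 := pow2_ge_0 (im (f x) - im (f y))).
        assert (H5 := Rmult_le_pos _ _ Hb H3). assert (H6 := Rmult_le_pos _ _ Hb H4). lra.
      * specialize (Hc x). assert (H4 := pow2_ge_0 (im (f x))).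
        assert (H6 := Rmult_le_pos _ _ Hc H4). lra.
    + apply finite_energy_comparison with (2 := K).
      intros [[x y]|x]; simpl wt; simpl diff; unfold G1, G2; rewrite Cmod_sq; simpl.
      * specialize (Hb x y). assert (H3 := pow2_ge_0 (re (f x) - re (f y))).
        assert (H4 := pow2_ge_0 (im (f x) - im (f y))).
        assert (H5 := Rmult_le_pos _ _ Hb H3). assert (H6 := Rmult_le_pos _ _ Hb H4). lra.
      * specialize (Hc x). assert (H4 := pow2_ge_0 (re (f x))).
        assert (H6 := Rmult_le_pos _ _ Hc H4). lra.
  - intros [[s1 H1] [s2 H2]].
    assert (K := has_sum_scal 2 _ _ (has_sum_plus _ _ _ _ H1 H2)).
    assert (Hpos : forall t, 0 <= 2 * (wt t * diff (fun x => re (f x)) t ^ 2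
      + wt t * diff (fun x => im (f x)) t ^ 2)).
    { intros t. assert (P1 := energy_term_nonneg (fun x => re (f x)) t).
      assert (P2 := energy_term_nonneg (fun x => im (f x)) t). lra. }
    split; exists (2 * (s1 + s2)); intros l Hl.
    + assert (Hnd : NoDup (map (@inl (X * X) X) l))
        by (apply NoDup_map_NoDup_ForallPairs; auto; intros ? ? _ _; congruence).
      apply Rle_trans with (2 := has_sum_finite_le _ _ _ Hpos K Hnd).
      rewrite Rsum_list_map. apply Rsum_list_le. intros [x y] _.
      rewrite Cmod_sq; simpl; lra.
    + assert (Hnd : NoDup (map (@inr (X * X) X) l))
        by (apply NoDup_map_NoDup_ForallPairs; auto; intros ? ? _ _; congruence).
      apply Rle_trans with (2 := has_sum_finite_le _ _ _ Hpos K Hnd).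
      rewrite Rsum_list_map. apply Rsum_list_le. intros x _.
      rewrite Cmod_sq; simpl. specialize (Hc x).
      assert (H3 := Rmult_le_pos _ _ Hc (pow2_ge_0 (re (f x)))).
      assert (H4 := Rmult_le_pos _ _ Hc (pow2_ge_0 (im (f x)))). lra.
Qed.

Lemma finite_energy_bounded f : finite_energy f -> exists M, forall x, Rabs (f x) <= M.
Proof.
  intros Hf. destruct (Hcc (fun x => RtoC (f x))) as [M HM].
  - apply Qfinite_iff; split; simpl; auto.
    apply finite_support_energy; exists []; auto.
  - exists M; intros x; rewrite <- Cmod_RtoC; apply HM.
Qed.

(** * The sup norm estimate for finitely supported functions *)

Fixpoint running_max (h : nat -> X -> R) (n : nat) (x : X) : R :=
  match n with
  | O => h O x
  | S k => Rmax (running_max h k x) (h (S k) x)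
  end.

Lemma running_max_ge h n x : h n x <= running_max h n x.
Proof. destruct n; simpl; [lra|apply Rmax_r]. Qed.

Lemma running_max_le h n x K : (forall m, h m x <= K) -> running_max h n x <= K.
Proof. intros H; induction n; simpl; auto. now apply Rmax_lub. Qed.

Lemma diff_Rmax f g t :
  diff (fun x => Rmax (f x) (g x)) t ^ 2 <= diff f t ^ 2 + diff g t ^ 2.
Proof.
  destruct t as [[x y]|x]; simpl diff; [apply Rmax_diff_sq|].
  assert (H := Rmax_diff_sq (f x) 0 (g x) 0).
  rewrite (Rmax_left 0 0) in H by lra. rewrite !Rminus_0_r in H. exact H.
Qed.

(** Running maxima have energy at most a partial sum of the geometric series, hence below 2. The
    bound passes to the pointwise supremum one finite partial sum at a time, as in Fatou's lemma. *)
Lemma energy_sup_finite (h : nat -> X -> R) :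
  (forall n, exists s, energy (h n) s /\ s <= (/ 2) ^ n) ->
  (forall x, exists K, forall n, h n x <= K) ->
  exists H, finite_energy H /\ forall n x, h n x <= H x.
Proof.
  intros Hs HK.
  assert (Hfin : forall N l, NoDup l ->
    Rsum_list (fun t => wt t * diff (running_max h N) t ^ 2) l <= 2 - (/ 2) ^ N).
  { intros N l Hl.
    assert (Hh : forall n, Rsum_list (fun t => wt t * diff (h n) t ^ 2) l <= (/ 2) ^ n).
    { intros n. destruct (Hs n) as [s [Hs1 Hs2]].
      apply Rle_trans with (2 := Hs2).
      apply has_sum_finite_le; auto. apply energy_term_nonneg. }
    induction N as [|N IH].
    - specialize (Hh O). simpl in Hh. simpl running_max. simpl pow at 2.
      replace (fun t => wt t * diff (fun x => h 0%nat x) t ^ 2)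
        with (fun t => wt t * (diff (h O) t * (diff (h O) t * 1))); [lra|reflexivity].
    - apply Rle_trans with (Rsum_list (fun t => wt t * diff (running_max h N) t ^ 2
        + wt t * diff (h (S N)) t ^ 2) l).
      + apply Rsum_list_le; intros t _.
        assert (H1 := diff_Rmax (running_max h N) (h (S N)) t).
        assert (H2 := wt_nonneg t). rewrite <- Rmult_plus_distr_l.
        now apply Rmult_le_compat_l.
      + rewrite Rsum_list_plus. specialize (Hh (S N)). simpl pow in *. lra. }
  assert (Hgrow : forall x, Un_growing (fun n => running_max h n x)).
  { intros x n; simpl; apply Rmax_l. }
  assert (Hcv : forall x, exists l, Un_cv (fun n => running_max h n x) l).
  { intros x. destruct (HK x) as [K HKx].
    destruct (growing_cv _ (Hgrow x)) as [l Hl]; [|eauto].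
    exists K; intros r [n ->]. now apply running_max_le. }
  apply choice_fun in Hcv. destruct Hcv as [H HH].
  exists H; split.
  - destruct (has_sum_of_bounded (fun t => wt t * diff H t ^ 2) 2) as [s [Hs' _]];
      [apply energy_term_nonneg| |now exists s].
    intros l Hl.
    apply (Un_cv_le_const
      (fun N => Rsum_list (fun t => wt t * diff (running_max h N) t ^ 2) l)).
    + apply Un_cv_Rsum_list. intros t.
      assert (Hd : Un_cv (fun n => diff (running_max h n) t) (diff H t)).
      { destruct t as [[x y]|x]; simpl; auto. now apply CV_minus. }
      apply (CV_mult (fun _ => wt t)).
      * intros eps He; exists O; intros; rewrite Rdist_eq; auto.
      * simpl. apply CV_mult; auto. apply CV_mult; auto.
        intros eps He; exists O; intros; rewrite Rdist_eq; auto.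
    + intros N. specialize (Hfin N l Hl).
      assert (0 < (/ 2) ^ N) by (apply pow_lt; lra). lra.
  - intros n x. apply Rle_trans with (1 := running_max_ge h n x).
    apply (growing_ineq (fun n => running_max h n x)); auto.
Qed.

(* If the estimate failed, there would be functions with energies at most [2 ^ -n] and
   values [n]; normalised at a base point, their supremum would be an unbounded function
   of finite energy. *)
Lemma finite_support_sup_bound :
  exists C, 0 < C /\ forall f s x, finite_support f -> energy f s -> f x ^ 2 <= C * s.
Proof.
  apply NNPP; intros Hn.
  assert (Hf : forall n : nat, exists f, finite_support f /\
    (exists s, energy f s /\ s <= (/ 2) ^ n) /\ exists x, f x = INR n).
  (* A counterexample for [C + 1], rescaled to take the value [INR n] at [x], has energy at most
     [(/ 2) ^ n]. Adding 1 keeps the constant positive when [n] is 0. *)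
  { intros n. set (C := INR n ^ 2 * 2 ^ n).
    assert (HC : 0 <= C) by (apply Rmult_le_pos; [apply pow2_ge_0|apply pow_le; lra]).
    apply NNPP; intros Hn'. apply Hn. exists (C + 1); split; [lra|].
    intros f s x Hfs Hen. apply Rnot_lt_le; intros Hlt. apply Hn'.
    assert (Hs := energy_nonneg f s Hen).
    assert (Hx : 0 < f x ^ 2) by nra.
    assert (Hx0 : f x <> 0) by (intros E; rewrite E in Hx; simpl in Hx; lra).
    exists (fun y => INR n / f x * f y); split; [now apply finite_support_scal|].
    split; [|exists x; field; auto].
    exists ((INR n / f x) ^ 2 * s); split; [now apply energy_scal|].
    rewrite pow_inv. replace ((INR n / f x) ^ 2 * s) with (INR n ^ 2 * s / f x ^ 2)
      by (field; auto).
    assert (H2 : 0 < 2 ^ n) by (apply pow_lt; lra).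
    apply Rmult_le_reg_r with (f x ^ 2); auto.
    apply Rmult_le_reg_r with (2 ^ n); auto.
    replace (INR n ^ 2 * s / f x ^ 2 * f x ^ 2 * 2 ^ n) with (C * s)
      by (unfold C; field; auto).
    replace (/ 2 ^ n * f x ^ 2 * 2 ^ n) with (f x ^ 2) by (field; lra). lra. }
  apply choice_fun in Hf. destruct Hf as [f Hf].
  assert (Hs1 : forall n, exists s, energy (f n) s /\ s <= 1).
  { intros n. destruct (Hf n) as [_ [[s [Hs Hs']] _]]. exists s; split; auto.
    apply Rle_trans with (1 := Hs'). rewrite <- (pow1 n).
    apply pow_incr; lra. }
  (* If [c] is positive at some [o], the energy bounds [f n o] and nothing is subtracted. If [c] is
     zero, subtracting the constant [f n o] costs no energy, and a bound on [f n - a n] still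
     controls [a n], because [f n] is zero somewhere. *)
  assert (Ha : exists (a : nat -> R) (o : X) (K : R),
    (forall n, Rabs (f n o - a n) <= K) /\
    (forall n t, wt t * diff (fun x => Rabs (f n x - a n)) t ^ 2 <= wt t * diff (f n) t ^ 2) /\
    (forall n M, (forall x, Rabs (f n x - a n) <= M) -> Rabs (a n) <= M)).
  { assert (Hlip : forall u v a, (Rabs (u - a) - Rabs (v - a)) ^ 2 <= (u - v) ^ 2).
    { intros u v a. rewrite <- (pow2_abs (u - v)). apply pow_maj_Rabs.
      apply Rle_trans with (1 := Rabs_triang_inv2 _ _). right; f_equal; ring. }
    destruct (classic (exists o, 0 < c o)) as [[o Ho]|Hno].
    - exists (fun _ => 0), o, (1 + / c o); split; [|split].
      + intros n. destruct (Hs1 n) as [s [Hs Hs']].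
        assert (H := energy_term_le (f n) s (inr o) Hs); simpl wt in H; simpl diff in H.
        assert (Hi := Rinv_0_lt_compat _ Ho).
        assert (E : c o * / c o = 1) by (field; lra).
        rewrite Rminus_0_r. apply Rabs_le; split; nra.
      + intros n [[x y]|x]; simpl wt; simpl diff.
        * apply Rmult_le_compat_l; [|apply Hlip]. exact (wt_nonneg (inl (x, y))).
        * rewrite Rminus_0_r, pow2_abs; lra.
      + intros n M H. rewrite Rabs_R0. apply Rle_trans with (2 := H o), Rabs_pos.
    - destruct (fresh_vertex []) as [o _].
      exists (fun n => f n o), o, 0; split; [|split].
      + intros n. rewrite Rminus_diag, Rabs_R0; lra.
      + intros n [[x y]|x]; simpl wt; simpl diff.
        * apply Rmult_le_compat_l; [|apply Hlip]. exact (wt_nonneg (inl (x, y))).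
        * replace (c x) with 0; [lra|].
          apply Rle_antisym; [exact (wt_nonneg (inr x))|].
          apply Rnot_lt_le; intros H; eauto.
      + intros n M H. destruct (Hf n) as [[l Hl] _].
        destruct (fresh_vertex l) as [x Hx]. specialize (H x).
        rewrite (Hl x Hx), Rminus_0_l, Rabs_Ropp in H. exact H. }
  destruct Ha as [a [o [K [HK [Hcontr Hrec]]]]].
  destruct (energy_sup_finite (fun n x => Rabs (f n x - a n))) as [H [HH Hle]].
  - intros n. destruct (Hf n) as [_ [[s [Hs Hs']] _]].
    destruct (energy_contraction _ _ s (Hcontr n) Hs) as [s' [H1 H2]].
    exists s'; split; auto; lra.
  - apply (connected_ind (fun x => exists K, forall n, Rabs (f n x - a n) <= K) o);
      [eauto|].
    (* An edge of weight [b x y] with energy at most 1 allows an increment of at most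
       [sqrt (2 / b x y)]; [1 + 2 / b x y] is a bound for it without square roots. *)
    intros x y Hb [K' HK']. exists (K' + (1 + 2 / b x y)). intros n.
    destruct (Hs1 n) as [s [Hs Hs']].
    assert (H1 := energy_term_le (f n) s (inl (x, y)) Hs).
    assert (H2 := Hcontr n (inl (x, y))). simpl wt in *; simpl diff in *.
    specialize (HK' n). set (u := Rabs (f n x - a n)) in *; set (v := Rabs (f n y - a n)) in *.
    assert (Hi : 0 < / b x y) by (now apply Rinv_0_lt_compat).
    assert (E : b x y * / b x y = 1) by (field; lra).
    apply Rnot_lt_le; intros Hlt. unfold Rdiv in *.
    assert (H3 : 1 + 2 * / b x y < v - u) by lra.
    assert (H4 : (1 + 2 * / b x y) ^ 2 <= (u - v) ^ 2) by nra.
    assert (H5 : b x y * / 2 * (1 + 2 * / b x y) ^ 2 <= 1).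
    { apply Rle_trans with (b x y * / 2 * (u - v) ^ 2); [|lra].
      apply Rmult_le_compat_l; lra. }
    replace (b x y * / 2 * (1 + 2 * / b x y) ^ 2)
      with (b x y * / 2 + 2 * (b x y * / b x y) + 2 * (b x y * / b x y) * / b x y) in H5
      by (field; lra).
    rewrite E in H5. lra.
  (* The supremum is bounded by some [M], which bounds both [a n] and [f n - a n], whereas [f n]
     takes the value [INR n > 2 * M]. *)
  - destruct (finite_energy_bounded H HH) as [M HM].
    destruct (INR_unbounded (2 * M)) as [n Hn2].
    assert (HM' : forall x, Rabs (f n x - a n) <= M).
    { intros x. specialize (Hle n x); simpl in Hle. specialize (HM x).
      apply Rabs_le_inv in HM; lra. }
    destruct (Hf n) as [_ [_ [x Hx]]].
    assert (H1 := Hrec n M HM'). specialize (HM' x). rewrite Hx in HM'.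
    apply Rabs_le_inv in H1; apply Rabs_le_inv in HM'. lra.
Qed.

(** * The Dirichlet problem *)

Definition vanishing (f : X -> R) : Prop :=
  forall eps, 0 < eps -> exists l, forall x, ~ In x l -> Rabs (f x) <= eps.

(** The real functions of the algebra [inA]; see [inA_iff]. *)
Definition energy_closure (f : X -> R) : Prop :=
  forall eps, 0 < eps -> exists g, finite_energy g /\ forall x, Rabs (f x - g x) <= eps.

Lemma finite_energy_closure f : finite_energy f -> energy_closure f.
Proof.
  intros H eps He; exists f; split; auto. intros x; rewrite Rminus_diag, Rabs_R0; lra.
Qed.

Lemma energy_closure_bounded f : energy_closure f -> exists M, forall x, Rabs (f x) <= M.
Proof.
  intros H. destruct (H 1 Rlt_0_1) as [g [Hg' Hfg]].
  destruct (finite_energy_bounded g Hg') as [M HM].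
  exists (M + 1); intros x. specialize (Hfg x); specialize (HM x).
  apply Rabs_le_inv in Hfg; apply Rabs_le_inv in HM; apply Rabs_le; lra.
Qed.

Lemma energy_closure_closed f :
  (forall eps, 0 < eps -> exists g, energy_closure g /\ forall x, Rabs (f x - g x) <= eps) ->
  energy_closure f.
Proof.
  intros H eps He. destruct (H (eps / 2)) as [g [Hg' Hfg]]; [lra|].
  destruct (Hg' (eps / 2)) as [k [Hk Hgk]]; [lra|].
  exists k; split; auto. intros x. specialize (Hfg x); specialize (Hgk x).
  apply Rabs_le_inv in Hfg; apply Rabs_le_inv in Hgk; apply Rabs_le; lra.
Qed.

(** At a fixed vertex the Laplacian is Lipschitz for the sup norm, with constant [2 * B + c x] where
    [B] is the total edge weight at [x]. Approximants therefore need only be nearly harmonic at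
    [x]. *)
Lemma laplacian_limit h x M :
  (forall y, Rabs (h y) <= M) ->
  (forall eps, 0 < eps -> exists k s, (forall y, Rabs (h y - k y) <= eps) /\
    laplacian k x s /\ Rabs s <= eps) ->
  laplacian h x 0.
Proof.
  intros HM H. destruct (laplacian_exists h x M HM) as [s0 Hs0].
  destruct Hg as [Hb [_ [_ [Hs Hc]]]].
  destruct (summable_has_sum (b x) (Hb x) (Hs x)) as [B HB].
  assert (HB0 : 0 <= B).
  { apply Rle_trans with (b x x); auto. now apply has_sum_term_le. }
  specialize (Hc x).
  assert (Hle : forall eps, 0 < eps -> Rabs s0 <= eps * (1 + 2 * B + c x)).
  { intros eps He. destruct (H eps He) as [k [s [Hk [Hks Hse]]]].
    assert (Hd := laplacian_minus _ _ _ _ _ Hs0 Hks). unfold laplacian in Hd.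
    assert (H1 : forall y, - (2 * eps) <= h x - k x - (h y - k y) <= 2 * eps).
    { intros y. assert (H1 := Rabs_le_inv _ _ (Hk x)).
      assert (H2 := Rabs_le_inv _ _ (Hk y)). lra. }
    assert (Hup : s0 - s - c x * (h x - k x) <= 2 * eps * B).
    { apply has_sum_le with (2 := Hd) (3 := has_sum_scal (2 * eps) _ _ HB).
      intros y. specialize (H1 y); specialize (Hb x y). nra. }
    assert (Hlow : - (2 * eps) * B <= s0 - s - c x * (h x - k x)).
    { apply has_sum_le with (2 := has_sum_scal (- (2 * eps)) _ _ HB) (3 := Hd).
      intros y. specialize (H1 y); specialize (Hb x y). nra. }
    assert (H2 := Rabs_le_inv _ _ (Hk x)). apply Rabs_le_inv in Hse.
    apply Rabs_le; split; nra. }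
  assert (s0 = 0) as ->; auto.
  apply cond_eq; intros eps He. rewrite Rminus_0_r.
  set (Q := 1 + 2 * B + c x) in *. assert (HQ : 0 < Q) by (unfold Q; lra).
  apply Rle_lt_trans with (eps / (2 * Q) * Q).
  - apply Hle. apply Rdiv_lt_0_compat; lra.
  - replace (eps / (2 * Q) * Q) with (eps / 2) by (field; lra). lra.
Qed.

(** Near minimality is used twice: with the parallelogram identity it makes the functions [g n]
    uniformly Cauchy, and with the first variation at a vertex it makes [f - g n] nearly harmonic
    there. *)
Lemma dirichlet_finite_energy f :
  finite_energy f ->
  exists h, energy_closure h /\ (forall x, laplacian h x 0) /\ vanishing (fun x => h x - f x).
Proof.
  intros Hf.
  set (E := fun r => exists g, finite_support g /\ energy (fun x => f x - g x) r).
  assert (HI : exists I, (forall r, E r -> I <= r) /\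
    forall eps, 0 < eps -> exists r, E r /\ r <= I + eps).
  { destruct (completeness (fun r => E (- r))) as [J [HJ1 HJ2]].
    - exists 0; intros r [g [_ Hr]]. apply energy_nonneg in Hr; lra.
    - destruct Hf as [s Hs]. exists (- s), (fun _ => 0); split; [now exists []|].
      rewrite Ropp_involutive. eapply has_sum_ext; [|exact Hs].
      intros [[x y]|x]; simpl; ring.
    - exists (- J); split.
      + intros r Hr. assert (- r <= J); [|lra]. apply HJ1. now rewrite Ropp_involutive.
      + intros eps He. apply NNPP; intros Hn. assert (J <= J - eps); [|lra].
        apply HJ2; intros r Hr. apply Rnot_lt_le; intros Hlt. apply Hn.
        exists (- r); split; auto; lra. }
  destruct HI as [I [HI1 HI2]].
  set (d := fun n => / (INR n + 1)).
  assert (Hd : forall n, 0 < d n).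
  { intros n; apply Rinv_0_lt_compat. assert (H := pos_INR n); lra. }
  (* The tolerance is a square because the sup norm is controlled by the square root of the energy;
     the rate of convergence is then linear in [d n]. *)
  assert (Hg' : forall n, exists g, finite_support g /\
    exists r, energy (fun x => f x - g x) r /\ r <= I + d n ^ 2).
  { intros n. destruct (HI2 (d n ^ 2)) as [r [[g [Hg1 Hg2]] Hr]];
      [apply pow_lt, Hd|]. exists g; split; auto. exists r; auto. }
  apply choice_fun in Hg'. destruct Hg' as [g Hgn].
  destruct finite_support_sup_bound as [C [HC Hsup]].
  (* Chosen so that [2 * C <= K ^ 2], avoiding a square root. *)
  set (K := 2 * C + 1).
  destruct (uniform_limit g (fun n => K * d n)) as [G HG].
  - intros eps He. destruct (inv_INR_eventually (eps / K)) as [N HN].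
    + apply Rdiv_lt_0_compat; unfold K; lra.
    + exists N; intros n Hn. specialize (HN n Hn). fold (d n) in HN.
      apply (Rmult_lt_compat_l K) in HN; [|unfold K; lra].
      replace (K * (eps / K)) with eps in HN by (unfold K; field; lra). exact HN.
  - intros n m x.
    destruct (Hgn n) as [Hsn [rn [Hrn Hrn']]], (Hgn m) as [Hsm [rm [Hrm Hrm']]].
    assert (Hdm : finite_support (fun x => g n x - g m x)).
    { replace (fun x => g n x - g m x) with (fun x => g n x + -1 * g m x)
        by (apply functional_extensionality; intros; ring).
      apply finite_support_plus; auto. now apply finite_support_scal. }
    destruct (finite_energy_plus (fun x => f x - g n x) (fun x => f x - g m x))
      as [p Hp]; [now exists rn|now exists rm|].
    destruct (finite_support_energy _ Hdm) as [q Hq].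
    assert (Hq' : energy (fun x => (f x - g n x) - (f x - g m x)) q).
    { eapply has_sum_ext; [|exact Hq]. intros [[y z]|y]; simpl; ring. }
    assert (Hpar := energy_parallelogram _ _ _ _ _ _ Hrn Hrm Hp Hq').
    (* The midpoint of [g n] and [g m] is a competitor, so [p >= 4 * I], and the parallelogram
       identity bounds [q]. *)
    assert (HIp : I <= (/ 2) ^ 2 * p).
    { apply HI1. exists (fun x => / 2 * (g n x + g m x)); split.
      - apply finite_support_scal. now apply finite_support_plus.
      - eapply has_sum_ext; [|exact (energy_scal (/ 2) _ _ Hp)].
        intros [[y z]|y]; simpl; field. }
    assert (Hx := Hsup _ _ x Hdm Hq). simpl in Hx, HIp.
    assert (Hdn := Hd n); assert (Hdm' := Hd m).
    assert (Hq2 : q <= 2 * d n ^ 2 + 2 * d m ^ 2) by lra.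
    apply (Rmult_le_compat_l C) in Hq2; [|lra].
    assert (HK2 : (g n x - g m x) ^ 2 <= (K * d n + K * d m) ^ 2).
    { apply Rle_trans with (2 * C * (d n ^ 2 + d m ^ 2)); [simpl in *; lra|].
      replace ((K * d n + K * d m) ^ 2) with (K ^ 2 * (d n + d m) ^ 2) by ring.
      apply Rmult_le_compat; try nra. unfold K; nra. }
    assert (HKp : 0 <= K * d n + K * d m) by (unfold K; nra).
    apply Rabs_le; split; nra.
  - assert (HK : 0 < K) by (unfold K; lra).
    assert (Hsmall : forall L eps, 0 < L -> 0 < eps -> exists n, L * d n <= eps).
    { intros L eps HL He. destruct (inv_INR_cv (eps / L)) as [n [_ Hn]].
      - now apply Rdiv_lt_0_compat.
      - exists n. fold (d n) in Hn. apply (Rmult_lt_compat_l L) in Hn; auto.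
        replace (L * (eps / L)) with eps in Hn by (field; lra). lra. }
    assert (Happ : forall n x, Rabs (f x - G x - (f x - g n x)) <= K * d n).
    { intros n x. rewrite <- Rabs_Ropp.
      replace (- (f x - G x - (f x - g n x))) with (G x - g n x) by ring. apply HG. }
    assert (Hcl : energy_closure (fun x => f x - G x)).
    { intros eps He. destruct (Hsmall K eps HK He) as [n Hn].
      exists (fun x => f x - g n x); split.
      - destruct (Hgn n) as [_ [r [Hr _]]]; now exists r.
      - intros x; apply Rle_trans with (2 := Hn), Happ. }
    exists (fun x => f x - G x); split; [auto|split].
    + intros x. destruct (energy_closure_bounded _ Hcl) as [M HM].
      apply laplacian_limit with (1 := HM). intros eps He.
      destruct (laplacian_indicator_exists x) as [D HD].
      assert (HD0 : 0 <= D) by (apply energy_nonneg with (indicator x), energy_indicator, HD).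
      destruct (Hsmall (K + D + 1) eps) as [n Hn]; [lra|lra|].
      assert (Hdn := Hd n).
      destruct (Hgn n) as [Hsn [r [Hr Hr']]].
      destruct (finite_energy_bounded (fun x => f x - g n x)) as [M' HM']; [now exists r|].
      destruct (laplacian_exists _ x _ HM') as [s Hs].
      exists (fun x => f x - g n x), s; split; [|split; auto].
      * intros y. apply Rle_trans with (1 := Happ n y). nra.
      (* Almost the minimiser [- s / D] of the quadratic polynomial; [D + 1] is positive because [D]
         is nonnegative, so the division is safe. Comparison with [I] then gives
         [s ^ 2 <= d n ^ 2 * (D + 1)]. *)
      * set (k := - s / (D + 1)).
        assert (HIk : I <= r + 2 * k * s + k ^ 2 * D).
        { apply HI1. exists (fun y => g n y + - k * indicator x y); split.
          - apply finite_support_plus; auto. apply finite_support_scal.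
            apply finite_support_indicator.
          - eapply has_sum_ext; [|exact (energy_perturbation _ _ _ _ _ k Hr Hs HD)].
            intros [[y z]|y]; simpl; ring. }
        assert (Hk : k * (D + 1) = - s) by (unfold k; field; lra).
        assert (Hk2 : k ^ 2 * (D + 1) = - s * k) by (simpl; rewrite <- Hk; ring).
        assert (Hs2 : - s * k <= d n ^ 2) by (simpl in *; nra).
        assert (Hs3 : s ^ 2 <= d n ^ 2 * (D + 1)).
        { replace (s ^ 2) with (- s * k * (D + 1)) by (simpl; nra).
          apply Rmult_le_compat_r; lra. }
        assert (Hs4 : s ^ 2 <= (d n * (D + 1)) ^ 2).
        { apply Rle_trans with (1 := Hs3).
          replace ((d n * (D + 1)) ^ 2) with (d n ^ 2 * (D + 1) ^ 2) by ring.
          apply Rmult_le_compat_l; [apply pow2_ge_0|nra]. }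
        assert (0 <= d n * (D + 1)) by (apply Rmult_le_pos; lra).
        apply Rle_trans with (d n * (D + 1)); [apply Rabs_le; split; nra|nra].
    + intros eps He. destruct (Hsmall K eps HK He) as [n Hn].
      destruct (Hgn n) as [[l Hl] _]. exists l; intros x Hx.
      replace (f x - G x - f x) with (- (G x - g n x)) by (rewrite (Hl x Hx); ring).
      rewrite Rabs_Ropp. apply Rle_trans with (2 := Hn), HG.
Qed.

(** * The maximum principle and the Dirichlet problem on the closure *)

Lemma list_argmax (h : X -> R) (a : X) (l : list X) :
  exists m, forall y, In y (a :: l) -> h y <= h m.
Proof.
  revert a; induction l as [|z l IH]; intros a.
  - exists a; intros y [<-|[]]; lra.
  - destruct (IH z) as [m Hm]. destruct (Rle_dec (h a) (h m)) as [Hle|Hlt].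
    + exists m; intros y [<-|Hy]; auto.
    + exists a; intros y [<-|Hy]; [lra|]. specialize (Hm y Hy); lra.
Qed.

(** A value above [M] forces the maximum to be attained, since only a finite list can compete with
    it. At a maximum [m] all terms [b m z * (h m - h z)] are nonnegative while their sum is
    [- c m * h m <= 0]; this uses [h m > M >= 0]. Hence [h] is constant along edges, which
    contradicts its bound off the list. *)
Lemma maximum_principle h M :
  0 <= M -> (forall x, laplacian h x 0) ->
  (forall eps, 0 < eps -> exists l, forall x, ~ In x l -> h x <= M + eps) ->
  forall x, h x <= M.
Proof.
  intros HM Hh Hinf x0. apply Rnot_lt_le; intros Hlt.
  destruct (Hinf ((h x0 - M) / 2)) as [l Hl]; [lra|].
  destruct (list_argmax h x0 l) as [m Hm].
  assert (Hx0 : h x0 <= h m) by auto with datatypes.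
  assert (Hmax : forall y, h y <= h m).
  { intros y. destruct (classic (In y l)) as [Hy|Hy]; [auto with datatypes|].
    specialize (Hl y Hy); lra. }
  assert (Hconst : forall y, h y = h m).
  { apply (connected_ind (fun y => h y = h m) m); auto.
    intros x y Hb Hx. apply Rle_antisym; auto.
    destruct Hg as [Hb0 [_ [_ [_ Hc]]]]. specialize (Hc x).
    assert (Hpos : forall z, 0 <= b x z * (h x - h z)).
    { intros z. apply Rmult_le_pos; auto. specialize (Hmax z); lra. }
    assert (H := has_sum_term_le _ _ y Hpos (Hh x)). simpl in H. rewrite Hx in H.
    assert (b x y * (h m - h y) <= 0) by nra. nra. }
  destruct (fresh_vertex l) as [y Hy]. specialize (Hl y Hy). rewrite Hconst in Hl. lra.
Qed.

Lemma maximum_principle_abs h M :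
  0 <= M -> (forall x, laplacian h x 0) ->
  (forall eps, 0 < eps -> exists l, forall x, ~ In x l -> Rabs (h x) <= M + eps) ->
  forall x, Rabs (h x) <= M.
Proof.
  intros HM Hh Hinf x.
  assert (H1 : h x <= M).
  { apply (maximum_principle h M HM Hh). intros eps He.
    destruct (Hinf eps He) as [l Hl]; exists l; intros y Hy.
    specialize (Hl y Hy). apply Rabs_le_inv in Hl; lra. }
  assert (H2 : -1 * h x <= M).
  { apply (maximum_principle (fun y => -1 * h y) M HM).
    - intros y. replace 0 with (-1 * 0) by ring. apply laplacian_scal, Hh.
    - intros eps He. destruct (Hinf eps He) as [l Hl]; exists l; intros y Hy.
      specialize (Hl y Hy). apply Rabs_le_inv in Hl; lra. }
  apply Rabs_le; lra.
Qed.

Lemma dirichlet_closure F :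
  energy_closure F ->
  exists u, energy_closure u /\ (forall x, laplacian u x 0) /\ vanishing (fun x => u x - F x).
Proof.
  intros HF. set (d := fun n => / (INR n + 1)).
  assert (Hd : forall n, 0 < d n).
  { intros n; apply Rinv_0_lt_compat. assert (H := pos_INR n); lra. }
  assert (H : forall n, exists fh : (X -> R) * (X -> R),
    (forall x, Rabs (F x - fst fh x) <= d n) /\ energy_closure (snd fh) /\
    (forall x, laplacian (snd fh) x 0) /\ vanishing (fun x => snd fh x - fst fh x)).
  { intros n. destruct (HF (d n) (Hd n)) as [f [Hf HFf]].
    destruct (dirichlet_finite_energy f Hf) as [h Hh]. now exists (f, h). }
  apply choice_fun in H. destruct H as [fh Hfh].
  destruct (uniform_limit (fun n => snd (fh n)) d) as [u Hu].
  - apply inv_INR_eventually.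
  - intros n m. destruct (Hfh n) as [A1 [_ [A3 A4]]], (Hfh m) as [B1 [_ [B3 B4]]].
    (* At infinity the two harmonic functions differ by approximately the difference of two
       approximants of [F], hence by at most [d n + d m]. *)
    apply (maximum_principle_abs (fun x => snd (fh n) x - snd (fh m) x)).
    + assert (H1 := Hd n); assert (H2 := Hd m); lra.
    + intros x. replace 0 with (0 - 0) by ring. now apply laplacian_minus.
    + intros eps He. destruct (A4 (eps / 2)) as [l Hl]; [lra|].
      destruct (B4 (eps / 2)) as [l' Hl']; [lra|].
      exists (l ++ l'); intros x Hx.
      assert (H1 := Hl x (fun H => Hx (in_or_app _ _ _ (or_introl H)))).
      assert (H2 := Hl' x (fun H => Hx (in_or_app _ _ _ (or_intror H)))).
      specialize (A1 x); specialize (B1 x). simpl in *.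
      apply Rabs_le_inv in A1, B1, H1, H2. apply Rabs_le; lra.
  - assert (Hsmall : forall eps, 0 < eps -> exists n, d n <= eps).
    { intros eps He. destruct (inv_INR_cv eps He) as [n [_ Hn]].
      exists n; fold (d n) in Hn; lra. }
    assert (Hcl : energy_closure u).
    { apply energy_closure_closed. intros eps He. destruct (Hsmall eps He) as [n Hn].
      exists (snd (fh n)); split; [apply Hfh|].
      intros x; apply Rle_trans with (2 := Hn), Hu. }
    exists u; split; [auto|split].
    + intros x. destruct (energy_closure_bounded u Hcl) as [M HM].
      apply laplacian_limit with (1 := HM). intros eps He.
      destruct (Hsmall eps He) as [n Hn]. exists (snd (fh n)), 0; split; [|split].
      * intros y; apply Rle_trans with (2 := Hn), Hu.
      * apply Hfh.
      * rewrite Rabs_R0; lra.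
    + intros eps He. destruct (Hsmall (eps / 4)) as [n Hn]; [lra|].
      destruct (Hfh n) as [A1 [_ [_ A4]]].
      destruct (A4 (eps / 2)) as [l Hl]; [lra|]. exists l; intros x Hx.
      specialize (Hl x Hx); specialize (A1 x); specialize (Hu n x); simpl in *.
      apply Rabs_le_inv in Hl, A1, Hu. apply Rabs_le; lra.
Qed.

(** * The algebra generated by the finite energy functions and the constants *)

(** The real functions of [inAplus], by [inAplus_iff]. *)
Definition unital_closure (f : X -> R) : Prop :=
  exists a, energy_closure (fun x => f x - a).

Lemma energy_closure_plus f g :
  energy_closure f -> energy_closure g -> energy_closure (fun x => f x + g x).
Proof.
  intros Hf Hg' eps He. destruct (Hf (eps / 2)) as [f' [Hf1 Hf2]]; [lra|].
  destruct (Hg' (eps / 2)) as [g' [Hg1 Hg2]]; [lra|].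
  exists (fun x => f' x + g' x); split; [now apply finite_energy_plus|].
  intros x. specialize (Hf2 x); specialize (Hg2 x).
  apply Rabs_le_inv in Hf2, Hg2. apply Rabs_le; lra.
Qed.

(** [Phi] shrinks differences up to the factor [L]; [Phi 0 = 0] gives the same control of the vertex
    terms. *)
Lemma energy_closure_lipschitz L Phi f :
  lipschitz L Phi -> Phi 0 = 0 -> energy_closure f -> energy_closure (fun x => Phi (f x)).
Proof.
  intros HL H0 Hf eps He.
  assert (HL0 : 0 <= L).
  { specialize (HL 1 0). rewrite Rminus_0_r, Rabs_R1, Rmult_1_r in HL.
    apply Rle_trans with (2 := HL), Rabs_pos. }
  destruct (Hf (eps / (L + 1))) as [g [[s Hs] Hfg]]; [apply Rdiv_lt_0_compat; lra|].
  exists (fun x => Phi (g x)); split.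
  - apply finite_energy_comparison with (2 := has_sum_scal (L ^ 2) _ _ Hs).
    intros t. assert (H : Rabs (diff (fun x => Phi (g x)) t) <= L * Rabs (diff g t)).
    { destruct t as [[x y]|x]; simpl; auto.
      rewrite <- (Rminus_0_r (Phi (g x))), <- H0, <- (Rminus_0_r (g x)) at 1.
      apply Rle_trans with (1 := HL _ _). rewrite !Rminus_0_r; lra. }
    apply pow_maj_Rabs with (n := 2%nat) in H. rewrite Rpow_mult_distr, pow2_abs in H.
    assert (Hw := wt_nonneg t). simpl in *; nra.
  - intros x. apply Rle_trans with (1 := HL _ _).
    specialize (Hfg x). apply (Rmult_le_compat_l L) in Hfg; auto.
    apply Rle_trans with (1 := Hfg).
    replace eps with (eps / (L + 1) * (L + 1)) at 2 by (field; lra).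
    assert (0 < eps / (L + 1)) by (apply Rdiv_lt_0_compat; lra). nra.
Qed.

Lemma energy_closure_scal k f : energy_closure f -> energy_closure (fun x => k * f x).
Proof.
  apply (energy_closure_lipschitz (Rabs k) (fun u => k * u)); [|ring].
  intros u v. rewrite <- Rmult_minus_distr_l, Rabs_mult; lra.
Qed.

Lemma energy_closure_unital f : energy_closure f -> unital_closure f.
Proof.
  intros H; exists 0. replace (fun x => f x - 0) with f; auto.
  apply functional_extensionality; intros x; ring.
Qed.

Lemma unital_closure_const a : unital_closure (fun _ => a).
Proof.
  exists a. apply finite_energy_closure, finite_support_energy.
  exists []; intros x _; ring.
Qed.

Lemma unital_closure_plus f g :
  unital_closure f -> unital_closure g -> unital_closure (fun x => f x + g x).
Proof.
  intros [a Ha] [a' Ha']; exists (a + a').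
  replace (fun x => f x + g x - (a + a')) with (fun x => (f x - a) + (g x - a'))
    by (apply functional_extensionality; intros; ring).
  now apply energy_closure_plus.
Qed.

Lemma unital_closure_lipschitz L Phi f :
  lipschitz L Phi -> unital_closure f -> unital_closure (fun x => Phi (f x)).
Proof.
  intros HL [a Ha]; exists (Phi a).
  replace (fun x => Phi (f x) - Phi a)
    with (fun x => (fun u => Phi (u + a) - Phi a) (f x - a)).
  - apply (energy_closure_lipschitz L (fun u => Phi (u + a) - Phi a) (fun x => f x - a)); auto.
    + intros u v. replace (Phi (u + a) - Phi a - (Phi (v + a) - Phi a))
        with (Phi (u + a) - Phi (v + a)) by ring.
      replace (u - v) with (u + a - (v + a)) by ring. apply HL.
    + rewrite Rplus_0_l; ring.
  - apply functional_extensionality; intros x. do 2 f_equal; ring.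
Qed.

Lemma unital_closure_scal k f : unital_closure f -> unital_closure (fun x => k * f x).
Proof.
  apply (unital_closure_lipschitz (Rabs k) (fun u => k * u)).
  intros u v. rewrite <- Rmult_minus_distr_l, Rabs_mult; lra.
Qed.

Lemma unital_closure_minus f g :
  unital_closure f -> unital_closure g -> unital_closure (fun x => f x - g x).
Proof.
  intros Hf Hg'. replace (fun x => f x - g x) with (fun x => f x + -1 * g x)
    by (apply functional_extensionality; intros; ring).
  now apply unital_closure_plus, unital_closure_scal.
Qed.

Lemma unital_closure_bounded f : unital_closure f -> exists M, forall x, Rabs (f x) <= M.
Proof.
  intros [a Ha]. destruct (energy_closure_bounded _ Ha) as [M HM].
  exists (M + Rabs a); intros x. replace (f x) with (f x - a + a) by ring.
  apply Rle_trans with (1 := Rabs_triang _ _). specialize (HM x); simpl in HM; lra.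
Qed.

(** On the bounded range of [f], squaring agrees with the square of a truncation, which is
    Lipschitz. Products then follow by polarisation. *)
Lemma energy_closure_sq f : energy_closure f -> energy_closure (fun x => f x ^ 2).
Proof.
  intros Hf. destruct (energy_closure_bounded f Hf) as [M HM].
  destruct (fresh_vertex []) as [o _].
  assert (HM0 : 0 <= M) by (apply Rle_trans with (2 := HM o), Rabs_pos).
  replace (fun x => f x ^ 2) with (fun x => (fun u => Rmax (- M) (Rmin M u) ^ 2) (f x)).
  - apply (energy_closure_lipschitz (2 * M) (fun u => Rmax (- M) (Rmin M u) ^ 2)); auto.
    + intros u v. set (p := Rmax (- M) (Rmin M u)). set (q := Rmax (- M) (Rmin M v)).
      assert (Hpq : Rabs (p + q) <= 2 * M /\ Rabs (p - q) <= Rabs (u - v)).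
      { unfold p, q, Rmax, Rmin; repeat destruct Rle_dec; split; unfold Rabs;
          repeat destruct Rcase_abs; lra. }
      replace (p ^ 2 - q ^ 2) with ((p + q) * (p - q)) by ring. rewrite Rabs_mult.
      apply Rmult_le_compat; try apply Rabs_pos; apply Hpq.
    + rewrite Rmin_right, Rmax_right by lra. ring.
  - apply functional_extensionality; intros x. specialize (HM x).
    apply Rabs_le_inv in HM. rewrite Rmin_right, Rmax_right; lra.
Qed.

Lemma energy_closure_mult f g :
  energy_closure f -> energy_closure g -> energy_closure (fun x => f x * g x).
Proof.
  intros Hf Hg'. replace (fun x => f x * g x)
    with (fun x => / 4 * ((f x + g x) ^ 2 + -1 * (f x + -1 * g x) ^ 2))
    by (apply functional_extensionality; intros; field).
  apply energy_closure_scal, energy_closure_plus; [|apply energy_closure_scal];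
    apply energy_closure_sq, energy_closure_plus; auto; now apply energy_closure_scal.
Qed.

Lemma unital_closure_mult f g :
  unital_closure f -> unital_closure g -> unital_closure (fun x => f x * g x).
Proof.
  intros [a Ha] [a' Ha']; exists (a * a').
  replace (fun x => f x * g x - a * a')
    with (fun x => (f x - a) * (g x - a') + (a * (g x - a') + a' * (f x - a)))
    by (apply functional_extensionality; intros; ring).
  apply energy_closure_plus; [now apply (energy_closure_mult (fun x => f x - a))|].
  apply (energy_closure_plus (fun x => a * (g x - a')) (fun x => a' * (f x - a)));
    [apply (energy_closure_scal a _ Ha')|apply (energy_closure_scal a' _ Ha)].
Qed.

Lemma energy_closure_const a : summable_nonneg c -> energy_closure (fun _ => a).
Proof.
  intros Hc. apply finite_energy_closure.
  destruct (summable_has_sum c) as [s Hs]; auto; [apply Hg|].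
  set (G := fun t : X * X + X => match t with inl _ => 0 | inr x => c x end).
  apply finite_energy_comparison with (fun t => a ^ 2 * G t) (a ^ 2 * s).
  - intros [[x y]|x]; simpl; right; ring.
  - apply has_sum_scal, (has_sum_inj inr).
    + congruence.
    + intros [[x y]|x] H; auto. now destruct (H x).
    + exact Hs.
Qed.

(** Otherwise a finite energy approximant would satisfy [eps / 2 <= Rabs (g x)] everywhere, and its
    vertex energy would make [c] summable. *)
Lemma energy_closure_small k eps :
  ~ summable_nonneg c -> energy_closure k -> 0 < eps -> exists x, Rabs (k x) < eps.
Proof.
  intros Hc Hk He. apply NNPP; intros Hn. apply Hc.
  destruct (Hk (eps / 2)) as [g [[s Hs] Hkg]]; [lra|].
  exists ((2 / eps) ^ 2 * s); intros l Hl.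
  assert (Hge : forall x, (eps / 2) ^ 2 <= g x ^ 2).
  { intros x. rewrite <- (pow2_abs (g x)). apply pow_incr; split; [lra|].
    assert (H : eps <= Rabs (k x)) by (apply Rnot_lt_le; eauto).
    assert (H1 := Rabs_triang (k x - g x) (g x)).
    replace (k x - g x + g x) with (k x) in H1 by ring. specialize (Hkg x); lra. }
  assert (Hcx : forall x, 0 <= c x) by apply Hg.
  assert (Hp : 0 < (2 / eps) ^ 2) by (apply pow_lt, Rdiv_lt_0_compat; lra).
  apply Rle_trans with ((2 / eps) ^ 2 * Rsum_list (fun x => c x * g x ^ 2) l).
  - rewrite <- Rsum_list_scal. apply Rsum_list_le; intros x _.
    replace (c x) with ((2 / eps) ^ 2 * (c x * (eps / 2) ^ 2)) at 1 by (field; lra).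
    apply Rmult_le_compat_l; [lra|]. apply Rmult_le_compat_l; auto.
  - apply Rmult_le_compat_l; [lra|].
    replace (Rsum_list (fun x => c x * g x ^ 2) l)
      with (Rsum_list (fun t => wt t * diff g t ^ 2) (map inr l))
      by apply Rsum_list_map.
    apply has_sum_finite_le; auto; [apply energy_term_nonneg|].
    apply NoDup_map_NoDup_ForallPairs; auto. intros ? ? _ _; congruence.
Qed.

Lemma energy_closure_shift_unique f a a' :
  ~ summable_nonneg c -> energy_closure (fun x => f x - a) ->
  energy_closure (fun x => f x - a') -> a = a'.
Proof.
  intros Hc H H'. apply cond_eq; intros eps He.
  destruct (energy_closure_small (fun x => (f x - a') + -1 * (f x - a)) eps Hc) as [x Hx];
    auto.
  - apply energy_closure_plus; auto. apply (energy_closure_scal (-1) _ H).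
  - now replace (f x - a' + -1 * (f x - a)) with (a - a') in Hx by ring.
Qed.

(** The constant parts of the approximants have to converge as well. If [c] is summable they are
    absorbed into the closure; otherwise [energy_closure_small] provides a vertex where two
    approximants nearly reduce to their constants, so these are Cauchy. *)
Lemma unital_closure_closed f :
  (forall eps, 0 < eps -> exists g, unital_closure g /\ forall x, Rabs (f x - g x) <= eps) ->
  unital_closure f.
Proof.
  intros H. destruct (classic (summable_nonneg c)) as [Hc|Hc].
  - apply energy_closure_unital, energy_closure_closed. intros eps He.
    destruct (H eps He) as [g [[a Ha] Hfg]]. exists g; split; auto.
    replace g with (fun x => (g x - a) + a)
      by (apply functional_extensionality; intros; ring).
    apply energy_closure_plus; auto. now apply energy_closure_const.
  - set (d := fun n => / (INR n + 1)).
    assert (Hd : forall n, 0 < d n).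
    { intros n; apply Rinv_0_lt_compat. assert (H1 := pos_INR n); lra. }
    assert (H' : forall n, exists p : (X -> R) * R,
      energy_closure (fun x => fst p x - snd p) /\ forall x, Rabs (f x - fst p x) <= d n).
    { intros n. destruct (H (d n) (Hd n)) as [g [[a Ha] Hfg]]. now exists (g, a). }
    apply choice_fun in H'. destruct H' as [p Hp].
    (* A sequence of reals is treated as a sequence of functions on a point. *)
    destruct (uniform_limit (fun n (_ : unit) => snd (p n)) d) as [a Ha].
    + apply inv_INR_eventually.
    + intros n m _. apply le_epsilon; intros eps He.
      destruct (Hp n) as [A1 A2], (Hp m) as [B1 B2].
      destruct (energy_closure_small
        (fun x => (fst (p n) x - snd (p n)) + -1 * (fst (p m) x - snd (p m))) eps Hc)
        as [x Hx]; auto.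
      * apply energy_closure_plus; auto. apply (energy_closure_scal (-1) _ B1).
      * specialize (A2 x); specialize (B2 x).
        apply Rabs_le_inv in A2, B2. apply Rabs_def2 in Hx. apply Rabs_le; lra.
    + exists (a tt). apply energy_closure_closed. intros eps He.
      destruct (inv_INR_cv (eps / 2)) as [n [_ Hn]]; [lra|]. fold (d n) in Hn.
      destruct (Hp n) as [A1 A2].
      exists (fun x => fst (p n) x - snd (p n)); split; auto.
      intros x. specialize (A2 x); specialize (Ha n tt); simpl in Ha.
      apply Rabs_le_inv in A2, Ha. apply Rabs_le; lra.
Qed.

Lemma inA_iff (f : X -> Cplx) :
  inA b c f <-> energy_closure (fun x => re (f x)) /\ energy_closure (fun x => im (f x)).
Proof.
  split.
  - intros [_ H]; split; intros eps He; destruct (H eps He) as [g [[Hq _] Hfg]];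
      apply Qfinite_iff in Hq; [exists (fun x => re (g x))|exists (fun x => im (g x))];
      (split; [apply Hq|]); intros x; apply Rle_trans with (2 := Hfg x);
      [apply (Rabs_re_le (Csub (f x) (g x)))|apply (Rabs_im_le (Csub (f x) (g x)))].
  - intros [H1 H2]; split.
    + destruct (energy_closure_bounded _ H1) as [M1 HM1].
      destruct (energy_closure_bounded _ H2) as [M2 HM2].
      exists (M1 + M2); intros x. apply Rle_trans with (1 := Cmod_le_abs _).
      specialize (HM1 x); specialize (HM2 x); simpl in *; lra.
    + intros eps He. destruct (H1 (eps / 2)) as [g1 [Hq1 Hg1]]; [lra|].
      destruct (H2 (eps / 2)) as [g2 [Hq2 Hg2]]; [lra|].
      exists (fun x => mkC (g1 x) (g2 x)); split.
      * assert (Hq : Qfinite b c (fun x => mkC (g1 x) (g2 x)))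
          by (apply Qfinite_iff; now split).
        split; auto.
      * intros x. apply Rle_trans with (1 := Cmod_le_abs _).
        specialize (Hg1 x); specialize (Hg2 x).
        change (Rabs (re (f x) - g1 x) + Rabs (im (f x) - g2 x) <= eps). lra.
Qed.

(** The functions on the right form a C*-subalgebra, to which minimality applies; conversely each of
    them is an element of [inA] plus a constant. *)
Lemma inAplus_iff (f : X -> Cplx) :
  inAplus b c f <-> unital_closure (fun x => re (f x)) /\ unital_closure (fun x => im (f x)).
Proof.
  split.
  - intros H. apply (H (fun f => unital_closure (fun x => re (f x)) /\
      unital_closure (fun x => im (f x)))).
    + repeat split; simpl.
      * intros g [H1 H2]. destruct (unital_closure_bounded _ H1) as [M1 HM1].
        destruct (unital_closure_bounded _ H2) as [M2 HM2].
        exists (M1 + M2); intros x. apply Rle_trans with (1 := Cmod_le_abs _).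
        specialize (HM1 x); specialize (HM2 x); simpl in *; lra.
      * apply unital_closure_const.
      * apply unital_closure_const.
      * apply (unital_closure_plus _ _ (proj1 H0) (proj1 H1)).
      * apply (unital_closure_plus _ _ (proj2 H0) (proj2 H1)).
      * destruct H0. apply unital_closure_minus; now apply unital_closure_scal.
      * destruct H0. apply unital_closure_plus; now apply unital_closure_scal.
      * destruct H0, H1. apply unital_closure_minus; now apply unital_closure_mult.
      * destruct H0, H1. apply unital_closure_plus; now apply unital_closure_mult.
      * apply H0.
      * destruct H0 as [_ H0]. apply (unital_closure_scal (-1)) in H0.
        replace (fun x => - im (f0 x)) with (fun x => -1 * im (f0 x)); auto.
        apply functional_extensionality; intros; ring.
      * apply unital_closure_closed. intros eps He. destruct (proj2 H0 eps He) as [k [Hk Hd]].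
        exists (fun x => re (k x)); split; [apply Hk|].
        intros x; apply Rle_trans with (2 := Hd x), (Rabs_re_le (Csub (g x) (k x))).
      * apply unital_closure_closed. intros eps He. destruct (proj2 H0 eps He) as [k [Hk Hd]].
        exists (fun x => im (k x)); split; [apply Hk|].
        intros x; apply Rle_trans with (2 := Hd x), (Rabs_im_le (Csub (g x) (k x))).
    + intros g Hg'. apply inA_iff in Hg'. destruct Hg'.
      split; now apply energy_closure_unital.
    + split; [exact (unital_closure_const 1)|exact (unital_closure_const 0)].
  - intros [[a Ha] [a' Ha']] S [_ [_ [Hadd [Hscal _]]]] HA H1.
    replace f with (fun x => Cadd (mkC (re (f x) - a) (im (f x) - a'))
      (Cmul (mkC a a') (one x))).
    + apply Hadd; auto. apply HA, inA_iff; now split.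
    + apply functional_extensionality; intros x; apply Cplx_eq; simpl; ring.
Qed.

(** * Characters *)

Definition real_value (gam : (X -> Cplx) -> Cplx) (f : X -> R) : R :=
  re (gam (fun x => RtoC (f x))).

Lemma inAplus_real f : unital_closure f -> inAplus b c (fun x => RtoC (f x)).
Proof. intros H; apply inAplus_iff; split; auto. exact (unital_closure_const 0). Qed.

Lemma inAplus_const z : inAplus b c (fun _ => z).
Proof.
  apply inAplus_iff; split;
    [exact (unital_closure_const (re z))|exact (unital_closure_const (im z))].
Qed.

Section Character.

Context (gam : (X -> Cplx) -> Cplx) (Hgam : character b c gam).

Lemma character_one : gam one = Defs.C1.
Proof.
  destruct Hgam as [_ [_ [Hmul [f [Hf Hf0]]]]].
  apply Cmul_fixed_eq_one with (1 := Hf0).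
  rewrite <- Hmul by (auto; exact (inAplus_const Defs.C1)).
  f_equal. apply functional_extensionality; intros x.
  apply Cplx_eq; simpl; ring.
Qed.

Lemma character_const z : gam (fun _ => z) = z.
Proof.
  destruct Hgam as [_ [Hscal _]].
  replace (fun _ : X => z) with (fun x : X => Cmul z (one x)).
  - rewrite Hscal by exact (inAplus_const Defs.C1). rewrite character_one.
    apply Cplx_eq; simpl; ring.
  - apply functional_extensionality; intros x. apply Cplx_eq; simpl; ring.
Qed.

(** The sum of the products of [f - z] with [f] minus the conjugate of [z], where [z] is the value
    of [gam] at [f]. The imaginary parts stay in because their vanishing is deduced from this
    function. *)
Definition sq_dist (fs : list (X -> R)) (x : X) : R :=
  Rsum_list (fun f => (f x - re (gam (fun y => RtoC (f y)))) ^ 2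
    + im (gam (fun y => RtoC (f y))) ^ 2) fs.

Lemma character_sq_dist fs :
  (forall f, In f fs -> unital_closure f) ->
  unital_closure (sq_dist fs) /\ gam (fun x => RtoC (sq_dist fs x)) = C0.
Proof.
  induction fs as [|f fs IH]; intros Hfs.
  - split; [exact (unital_closure_const 0)|exact (character_const C0)].
  - destruct IH as [IH1 IH2]; [auto with datatypes|].
    assert (Hf : unital_closure f) by auto with datatypes.
    set (z := gam (fun y => RtoC (f y))).
    set (G := fun x => (f x - re z) ^ 2 + im z ^ 2).
    assert (HG : unital_closure G).
    { apply unital_closure_plus; [|exact (unital_closure_const (im z ^ 2))].
      assert (Hm : unital_closure (fun x => f x - re z))
        by (apply unital_closure_minus; auto; apply unital_closure_const).
      replace (fun x => (f x - re z) ^ 2) with (fun x => (f x - re z) * (f x - re z))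
        by (apply functional_extensionality; intros; ring).
      now apply (unital_closure_mult (fun x => f x - re z)). }
    split; [exact (unital_closure_plus _ _ HG IH1)|].
    destruct Hgam as [Hadd [_ [Hmul _]]].
    replace (fun x => RtoC (sq_dist (f :: fs) x))
      with (fun x => Cadd (RtoC (G x)) (RtoC (sq_dist fs x)))
      by (apply functional_extensionality; intros x; apply Cplx_eq; [reflexivity|simpl; ring]).
    rewrite Hadd, IH2 by now apply inAplus_real.
    replace (fun x => RtoC (G x)) with (fun x =>
      Cmul (Cadd (RtoC (f x)) (Copp z)) (Cadd (RtoC (f x)) (Copp (Cconj z))))
      by (apply functional_extensionality; intros x; apply Cplx_eq; unfold G; simpl; ring).
    assert (Hin : forall w, inAplus b c (fun x => Cadd (RtoC (f x)) w)).
    { intros w. apply inAplus_iff; simpl; split;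
        apply unital_closure_plus; auto; apply unital_closure_const. }
    rewrite Hmul, Hadd, character_const by auto using inAplus_real, inAplus_const.
    fold z. apply Cplx_eq; simpl; ring.
Qed.

(* Otherwise [sq_dist fs], which the character kills, would be invertible in the algebra. *)
Lemma character_sq_dist_small fs eps :
  (forall f, In f fs -> unital_closure f) -> 0 < eps -> exists x, sq_dist fs x < eps.
Proof.
  intros Hfs He. apply NNPP; intros Hn.
  assert (Hge : forall x, eps <= sq_dist fs x) by (intros x; apply Rnot_lt_le; eauto).
  destruct (character_sq_dist fs Hfs) as [HG H0].
  set (K := fun x => / Rmax eps (sq_dist fs x)).
  assert (HK : unital_closure K)
    by exact (unital_closure_lipschitz _ _ _ (lipschitz_inv_Rmax eps He) HG).
  assert (H1 := character_one).
  replace one with (fun x => Cmul (RtoC (sq_dist fs x)) (RtoC (K x))) in H1.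
  - destruct Hgam as [_ [_ [Hmul _]]].
    rewrite Hmul, H0 in H1 by now apply inAplus_real.
    apply (f_equal re) in H1; simpl in H1; lra.
  - apply functional_extensionality; intros x. specialize (Hge x).
    unfold K. apply Cplx_eq; simpl; [|ring].
    rewrite Rmax_right by auto. field; lra.
Qed.

Lemma sq_dist_ge f fs x :
  In f fs -> (f x - re (gam (fun y => RtoC (f y)))) ^ 2
    + im (gam (fun y => RtoC (f y))) ^ 2 <= sq_dist fs x.
Proof.
  intros Hf. set (T := fun f => (f x - re (gam (fun y => RtoC (f y)))) ^ 2
    + im (gam (fun y => RtoC (f y))) ^ 2).
  assert (HT : forall k, 0 <= T k).
  { intros k; unfold T. apply Rplus_le_le_0_compat; apply pow2_ge_0. }
  change (T f <= Rsum_list T fs).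
  replace (T f) with (Rsum_list T [f]) by (simpl; lra).
  apply Rsum_list_incl; auto.
  - constructor; [easy|constructor].
  - intros k [<-|[]]; auto.
Qed.

(** For the list [[f]], [sq_dist] is at least the square of the imaginary part of the value, yet
    takes arbitrarily small values. *)
Lemma character_real f :
  unital_closure f -> gam (fun x => RtoC (f x)) = RtoC (real_value gam f).
Proof.
  intros Hf. apply Cplx_eq; [reflexivity|]. simpl.
  apply NNPP; intros Him. apply pow_nonzero with (n := 2%nat) in Him.
  set (w := im (gam (fun x => RtoC (f x)))) in *.
  assert (Hw : 0 < w ^ 2) by (assert (H := pow2_ge_0 w); lra).
  destruct (character_sq_dist_small [f] (w ^ 2)) as [x Hx]; auto.
  - intros k [<-|[]]; auto.
  - assert (H := sq_dist_ge f [f] x (or_introl eq_refl)). fold w in H.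
    assert (H2 := pow2_ge_0 (f x - re (gam (fun y => RtoC (f y))))). lra.
Qed.

(** The density of [X] among the characters, tested on finitely many real functions. *)
Lemma character_dense fs eps :
  (forall f, In f fs -> unital_closure f) -> 0 < eps ->
  exists x, forall f, In f fs -> Rabs (f x - real_value gam f) < eps.
Proof.
  intros Hfs He. destruct (character_sq_dist_small fs (eps ^ 2)) as [x Hx]; auto.
  { now apply pow_lt. }
  exists x; intros f Hf. assert (H := sq_dist_ge f fs x Hf).
  fold (real_value gam f) in H.
  assert (H2 := pow2_ge_0 (im (gam (fun y => RtoC (f y))))).
  apply Rabs_def1; nra.
Qed.

Lemma character_re_im f :
  inAplus b c f ->
  gam f = mkC (real_value gam (fun x => re (f x))) (real_value gam (fun x => im (f x))).
Proof.
  intros Hf. destruct (proj1 (inAplus_iff f) Hf) as [H1 H2].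
  destruct Hgam as [Hadd [Hscal _]].
  replace f with (fun x => Cadd (RtoC (re (f x))) (Cmul (mkC 0 1) (RtoC (im (f x))))) at 1
    by (apply functional_extensionality; intros x; apply Cplx_eq; simpl; ring).
  rewrite Hadd; [rewrite Hscal|..].
  - rewrite (character_real _ H1), (character_real _ H2). apply Cplx_eq; simpl; ring.
  - now apply inAplus_real.
  - now apply inAplus_real.
  - apply inAplus_iff; simpl; split;
      [apply unital_closure_minus|apply unital_closure_plus];
      apply unital_closure_scal; auto; apply unital_closure_const.
Qed.

Lemma real_value_const a : real_value gam (fun _ => a) = a.
Proof. unfold real_value. now rewrite (character_const (RtoC a)). Qed.

Lemma real_value_plus f g :
  unital_closure f -> unital_closure g ->
  real_value gam (fun x => f x + g x) = real_value gam f + real_value gam g.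
Proof.
  intros Hf Hg'. unfold real_value. destruct Hgam as [Hadd _].
  replace (fun x => RtoC (f x + g x)) with (fun x => Cadd (RtoC (f x)) (RtoC (g x)))
    by (apply functional_extensionality; intros x; apply Cplx_eq; simpl; ring).
  now rewrite Hadd by now apply inAplus_real.
Qed.

Lemma real_value_mult f g :
  unital_closure f -> unital_closure g ->
  real_value gam (fun x => f x * g x) = real_value gam f * real_value gam g.
Proof.
  intros Hf Hg'. unfold real_value at 1. destruct Hgam as [_ [_ [Hmul _]]].
  replace (fun x => RtoC (f x * g x)) with (fun x => Cmul (RtoC (f x)) (RtoC (g x)))
    by (apply functional_extensionality; intros x; apply Cplx_eq; simpl; ring).
  rewrite Hmul by now apply inAplus_real.
  rewrite (character_real f), (character_real g) by auto. simpl; ring.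
Qed.

Lemma real_value_scal k f :
  unital_closure f -> real_value gam (fun x => k * f x) = k * real_value gam f.
Proof.
  intros Hf. rewrite (real_value_mult (fun _ => k)); auto using unital_closure_const.
  now rewrite real_value_const.
Qed.

Lemma real_value_minus f g :
  unital_closure f -> unital_closure g ->
  real_value gam (fun x => f x - g x) = real_value gam f - real_value gam g.
Proof.
  intros Hf Hg'. replace (fun x => f x - g x) with (fun x => f x + -1 * g x)
    by (apply functional_extensionality; intros; ring).
  rewrite real_value_plus, real_value_scal; auto using unital_closure_scal. ring.
Qed.

(** Continuity of characters is automatic: by density, the estimate is read off at a vertex. *)
Lemma real_value_dist f g e :
  unital_closure f -> unital_closure g -> (forall x, Rabs (f x - g x) <= e) ->
  Rabs (real_value gam f - real_value gam g) <= e.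
Proof.
  intros Hf Hg' Hd. apply le_epsilon; intros eps He.
  destruct (character_dense [f; g] (eps / 2)) as [x Hx]; [|lra|].
  - intros k [<-|[<-|[]]]; auto.
  - assert (H1 := Hx f (or_introl eq_refl)).
    assert (H2 := Hx g (or_intror (or_introl eq_refl))). specialize (Hd x).
    apply Rabs_def2 in H1, H2. apply Rabs_le_inv in Hd. apply Rabs_le; lra.
Qed.

End Character.

(** * Boundary characters, free ultrafilters and compactness *)

Lemma unital_closure_indicator x : unital_closure (indicator x).
Proof.
  apply energy_closure_unital, finite_energy_closure, finite_support_energy.
  apply finite_support_indicator.
Qed.

(** Since [f] times the indicator of [y] is [f y] times that indicator, a nonzero value on it would
    make [gam] the evaluation at [y]. *)
Lemma boundary_indicator gam y : in_boundary b c gam -> real_value gam (indicator y) = 0.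
Proof.
  intros [Hgam Hne]. apply NNPP; intros H. apply (Hne y). intros f Hf.
  unfold delta. assert (Hi := unital_closure_indicator y).
  set (w := gam (fun x => RtoC (indicator y x))).
  assert (Hw : w = RtoC (real_value gam (indicator y))) by now apply character_real.
  destruct Hgam as [_ [Hscal [Hmul _]]].
  assert (E : Cmul (gam f) w = Cmul (f y) w).
  { unfold w. rewrite <- Hmul, <- Hscal by now auto using inAplus_real.
    f_equal. apply functional_extensionality; intros x.
    destruct (classic (x = y)) as [->|Hxy]; auto.
    rewrite indicator_neq by auto. apply Cplx_eq; simpl; ring. }
  rewrite Hw in E. set (r := real_value gam (indicator y)) in *.
  assert (E1 := f_equal re E); assert (E2 := f_equal im E); simpl in E1, E2.
  apply Cplx_eq; apply Rmult_eq_reg_r with r; auto; lra.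
Qed.

(** Adding the indicators of [l] with tolerance at most 1 keeps the approximating vertex off [l],
    because a boundary character sends them to 0. *)
Lemma boundary_dense gam fs l eps :
  in_boundary b c gam -> (forall f, In f fs -> unital_closure f) -> 0 < eps ->
  exists x, ~ In x l /\ forall f, In f fs -> Rabs (f x - real_value gam f) < eps.
Proof.
  intros Hb Hfs He.
  destruct (character_dense gam (proj1 Hb) (fs ++ map indicator l) (Rmin eps 1)) as [x Hx].
  - intros f Hf; apply in_app_or in Hf; destruct Hf as [Hf|Hf]; auto.
    apply in_map_iff in Hf. destruct Hf as [y [<- _]]. apply unital_closure_indicator.
  - apply Rmin_glb_lt; lra.
  - exists x; split.
    + intros Hl. assert (H := Hx (indicator x) (in_or_app _ _ _ (or_intror (in_map _ _ _ Hl)))).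
      rewrite boundary_indicator, indicator_eq, Rminus_0_r, Rabs_R1 in H by auto.
      assert (H1 := Rmin_r eps 1); lra.
    + intros f Hf. apply Rlt_le_trans with (1 := Hx f (in_or_app _ _ _ (or_introl Hf))).
      apply Rmin_l.
Qed.

Lemma boundary_vanishing gam f :
  in_boundary b c gam -> unital_closure f -> vanishing f -> real_value gam f = 0.
Proof.
  intros Hb Hf Hv. apply cond_eq; intros eps He. rewrite Rminus_0_r.
  destruct (Hv (eps / 2)) as [l Hl]; [lra|].
  destruct (boundary_dense gam [f] l (eps / 2) Hb) as [x [Hx Hfx]]; [|lra|].
  - intros k [<-|[]]; auto.
  - specialize (Hfx f (or_introl eq_refl)); specialize (Hl x Hx).
    apply Rabs_def2 in Hfx. apply Rabs_le_inv in Hl. apply Rabs_def1; lra.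
Qed.

(** The limit along [U]. The choice is meaningful on [inAplus], whose elements are bounded. *)
Definition ultrafilter_character (U : (X -> Prop) -> Prop) (f : X -> Cplx) : Cplx :=
  mkC (epsilon (inhabits 0) (ulim U (fun x => re (f x))))
      (epsilon (inhabits 0) (ulim U (fun x => im (f x)))).

Lemma ultrafilter_character_eq U f p q :
  ultrafilter U -> ulim U (fun x => re (f x)) p -> ulim U (fun x => im (f x)) q ->
  ultrafilter_character U f = mkC p q.
Proof.
  intros HU Hp Hq. unfold ultrafilter_character. f_equal.
  - apply (ulim_unique U HU (fun x => re (f x))); auto.
    apply (epsilon_spec (inhabits 0)); eauto.
  - apply (ulim_unique U HU (fun x => im (f x))); auto.
    apply (epsilon_spec (inhabits 0)); eauto.
Qed.

Lemma ultrafilter_character_spec U f :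
  ultrafilter U -> inAplus b c f ->
  ulim U (fun x => re (f x)) (re (ultrafilter_character U f)) /\
  ulim U (fun x => im (f x)) (im (ultrafilter_character U f)).
Proof.
  intros HU Hf. destruct (proj1 (inAplus_iff f) Hf) as [H1 H2].
  destruct (unital_closure_bounded _ H1) as [M1 HM1].
  destruct (unital_closure_bounded _ H2) as [M2 HM2].
  destruct (ulim_exists U HU _ _ HM1) as [p Hp].
  destruct (ulim_exists U HU _ _ HM2) as [q Hq].
  now rewrite (ultrafilter_character_eq U f p q).
Qed.

(** Limits respect the algebra operations. Freeness gives the indicator of [y] the value 0, which
    separates the character from evaluation at [y]. *)
Lemma ultrafilter_character_boundary U :
  ultrafilter U -> (forall y, U (fun x => x <> y)) ->
  in_boundary b c (ultrafilter_character U).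
Proof.
  intros HU Hfree.
  (* The real and imaginary parts of a complex product, stated once for scalars and for
     functions. *)
  assert (Hop : forall (p q r s : X -> R) (u v w z : R),
    ulim U p u -> ulim U q v -> ulim U r w -> ulim U s z ->
    ulim U (fun x => p x * r x - q x * s x) (u * w - v * z) /\
    ulim U (fun x => p x * s x + q x * r x) (u * z + v * w)).
  { intros p q r s u v w z Hp Hq Hr Hs. split.
    - replace (fun x => p x * r x - q x * s x) with (fun x => p x * r x + -1 * (q x * s x))
        by (apply functional_extensionality; intros; ring).
      replace (u * w - v * z) with (u * w + -1 * (v * z)) by ring.
      repeat (apply ulim_plus || apply ulim_mult); auto. now apply ulim_const.
    - repeat (apply ulim_plus || apply ulim_mult); auto. }
  split; [split; [|split; [|split]]|].
  - intros f g Hf Hg'. destruct (ultrafilter_character_spec U f HU Hf) as [F1 F2].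
    destruct (ultrafilter_character_spec U g HU Hg') as [G1 G2].
    apply ultrafilter_character_eq; auto; simpl; now apply ulim_plus.
  - intros a f Hf. destruct (ultrafilter_character_spec U f HU Hf) as [F1 F2].
    destruct (Hop _ _ _ _ _ _ _ _ (ulim_const U HU (re a)) (ulim_const U HU (im a)) F1 F2).
    now apply ultrafilter_character_eq.
  - intros f g Hf Hg'. destruct (ultrafilter_character_spec U f HU Hf) as [F1 F2].
    destruct (ultrafilter_character_spec U g HU Hg') as [G1 G2].
    destruct (Hop _ _ _ _ _ _ _ _ F1 F2 G1 G2).
    now apply ultrafilter_character_eq.
  - exists one; split; [exact (inAplus_const Defs.C1)|].
    rewrite (ultrafilter_character_eq U one 1 0 HU (ulim_const U HU 1) (ulim_const U HU 0)).
    intros E; apply (f_equal re) in E; simpl in E; lra.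
  - intros y E. specialize (E _ (inAplus_real _ (unital_closure_indicator y))).
    rewrite (ultrafilter_character_eq U _ 0 0 HU) in E; simpl.
    + unfold delta in E. rewrite indicator_eq in E.
      apply (f_equal re) in E; simpl in E; lra.
    + apply ulim_eventually_eq; auto. destruct HU as [HS _].
      apply HS with (2 := Hfree y). intros x; apply indicator_neq.
    + now apply ulim_const.
Qed.

Lemma ulim_real_value U f :
  ultrafilter U -> unital_closure f -> ulim U f (real_value (ultrafilter_character U) f).
Proof.
  intros HU Hf.
  exact (proj1 (ultrafilter_character_spec U _ HU (inAplus_real f Hf))).
Qed.

(** If some set where [Rabs (f x) > eps] is infinite, a free ultrafilter contains it, and its
    boundary character takes a nonzero value at [f]. *)
Lemma vanishing_of_boundary f :
  unital_closure f -> (forall gam, in_boundary b c gam -> real_value gam f = 0) ->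
  vanishing f.
Proof.
  intros Hf H eps He. apply NNPP; intros Hn.
  destruct (ultrafilter_exists (fun A : X -> Prop =>
    (exists y, forall x, x <> y -> A x) \/ (forall x, eps < Rabs (f x) -> A x)))
    as [U [HU HUA]].
  - intros l Hl.
    assert (Hex : exists ys, forall x, ~ In x ys -> eps < Rabs (f x) ->
      forall A, In A l -> A x).
    { clear Hn. induction l as [|A l IH]; [now exists []|].
      destruct IH as [ys Hys]; [auto with datatypes|].
      destruct (Hl A) as [[y Hy]|Hy]; [auto with datatypes| |].
      - exists (y :: ys). intros x Hx Hfx B [<-|HB].
        + apply Hy; intros ->; apply Hx; simpl; auto.
        + apply Hys; auto. intros HI; apply Hx; simpl; auto.
      - exists ys. intros x Hx Hfx B [<-|HB]; [auto|]. now apply Hys. }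
    destruct Hex as [ys Hys].
    assert (Hx : exists x, ~ In x ys /\ eps < Rabs (f x)).
    { apply NNPP; intros Hn'. apply Hn. exists ys; intros x Hx.
      apply Rnot_lt_le; intros Hlt; eauto. }
    destruct Hx as [x [Hx1 Hx2]]. exists x. now apply Hys.
  - assert (Hb : in_boundary b c (ultrafilter_character U)).
    { apply ultrafilter_character_boundary; auto.
      intros y; apply HUA; left; exists y; auto. }
    assert (Hlim := ulim_real_value U f HU Hf). rewrite H in Hlim by auto.
    assert (Hbig : U (fun x => eps < Rabs (f x))) by (apply HUA; auto).
    specialize (Hlim eps He). destruct HU as [HS [HI HU']].
    destruct (ultrafilter_inhabited U (conj HS (conj HI HU')) _ (HI _ _ Hlim Hbig))
      as [x [H1 H2]].
    rewrite Rminus_0_r in H1; lra.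
Qed.

(** Compactness stated on [X]: a cover of the boundary by positivity sets has a finite subfamily
    that covers all but finitely many vertices with a uniform margin. Otherwise a free ultrafilter
    contains every set where [g i x < d], and its character is positive on no [g i]. *)
Lemma boundary_compact {I : Type} (g : I -> X -> R) (P : I -> Prop) :
  (forall i, P i -> unital_closure (g i)) ->
  (forall gam, in_boundary b c gam -> exists i, P i /\ 0 < real_value gam (g i)) ->
  exists (is : list I) (d : R) (l : list X), (forall i, In i is -> P i) /\ 0 < d /\
    forall x, ~ In x l -> exists i, In i is /\ d <= g i x.
Proof.
  intros HP Hcov. apply NNPP; intros Hn.
  destruct (ultrafilter_exists (fun A : X -> Prop =>
    (exists y, forall x, x <> y -> A x) \/
    (exists i d, P i /\ 0 < d /\ forall x, g i x < d -> A x))) as [U [HU HUA]].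
  - intros l Hl.
    assert (Hex : exists is d ys, (forall i, In i is -> P i) /\ 0 < d /\
      forall x, ~ In x ys -> (forall i, In i is -> g i x < d) -> forall A, In A l -> A x).
    { clear Hn. induction l as [|A l IH].
      - exists [], 1, []; repeat split; try easy; lra.
      - destruct IH as [is [d [ys [His [Hd Hys]]]]]; [auto with datatypes|].
        destruct (Hl A) as [[y Hy]|[i [d' [Hi [Hd' HA]]]]]; [auto with datatypes| |].
        + exists is, d, (y :: ys); repeat split; auto. intros x Hx Hgx B [<-|HB].
          * apply Hy; intros ->; apply Hx; simpl; auto.
          * apply Hys; auto. intros HI; apply Hx; simpl; auto.
        + exists (i :: is), (Rmin d d'), ys; repeat split.
          * intros j [<-|Hj]; auto.
          * now apply Rmin_glb_lt.
          * intros x Hx Hgx B [<-|HB].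
            -- apply HA. apply Rlt_le_trans with (Rmin d d'); [auto with datatypes|apply Rmin_r].
            -- apply Hys; auto. intros j Hj.
               apply Rlt_le_trans with (Rmin d d'); [auto with datatypes|apply Rmin_l]. }
    destruct Hex as [is [d [ys [His [Hd Hys]]]]].
    apply NNPP; intros Hno. apply Hn. exists is, d, ys; repeat split; auto.
    intros x Hx. apply NNPP; intros Hnx. apply Hno. exists x. apply Hys; auto.
    intros i Hi. apply Rnot_le_lt; eauto.
  - assert (Hb : in_boundary b c (ultrafilter_character U)).
    { apply ultrafilter_character_boundary; auto.
      intros y; apply HUA; left; exists y; auto. }
    destruct (Hcov _ Hb) as [i [Hi Hpos]].
    set (r := real_value (ultrafilter_character U) (g i)) in *.
    assert (H1 := ulim_real_value U (g i) HU (HP i Hi) (r / 2) ltac:(lra)).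
    fold r in H1.
    assert (H2 : U (fun x => g i x < r / 2)).
    { apply HUA; right. exists i, (r / 2); repeat split; auto; lra. }
    destruct HU as [HS [HI HU']].
    destruct (ultrafilter_inhabited U (conj HS (conj HI HU')) _ (HI _ _ H1 H2))
      as [x [H3 H4]].
    apply Rabs_def2 in H3. lra.
Qed.

(** * Extension of continuous functions from the boundary *)

(* Neighbourhoods of [gam0] are described by sublevel sets of elements of the algebra that
   are nonnegative on the boundary and vanish at [gam0]: intersecting two of them amounts
   to adding these functions. *)
Definition boundary_continuous (psi : ((X -> Cplx) -> Cplx) -> R) : Prop :=
  forall gam0, in_boundary b c gam0 -> forall eps, 0 < eps ->
  exists (q : X -> R) (d : R), unital_closure q /\ 0 < d /\ real_value gam0 q = 0 /\
    forall gam, in_boundary b c gam -> 0 <= real_value gam q /\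
      (real_value gam q < d -> Rabs (psi gam - psi gam0) < eps).

Lemma unital_closure_sub_sq f a :
  unital_closure f -> unital_closure (fun x => (f x - a) * (f x - a)).
Proof.
  intros Hf. assert (H : unital_closure (fun x => f x - a))
    by (apply unital_closure_minus; auto; apply unital_closure_const).
  now apply (unital_closure_mult (fun x => f x - a)).
Qed.

Lemma real_value_sub_sq gam f a :
  character b c gam -> unital_closure f ->
  real_value gam (fun x => (f x - a) * (f x - a)) = (real_value gam f - a) ^ 2.
Proof.
  intros Hgam Hf. assert (Ha := unital_closure_const a).
  assert (H : unital_closure (fun x => f x - a)) by now apply unital_closure_minus.
  rewrite (real_value_mult gam Hgam (fun x => f x - a) (fun x => f x - a)) by auto.
  rewrite (real_value_minus gam Hgam f (fun _ => a)), (real_value_const gam Hgam) by auto.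
  ring.
Qed.

(** [q] is the sum over [fs] of the squared moduli of [f] minus its value at [gam0]; characters turn
    it into a sum of squared distances. *)
Lemma weak_neighbourhood_sublevel gam0 (fs : list (X -> Cplx)) :
  character b c gam0 -> (forall f, In f fs -> inAplus b c f) ->
  exists q, unital_closure q /\ real_value gam0 q = 0 /\
    forall gam, character b c gam -> 0 <= real_value gam q /\
      forall f, In f fs -> Cmod (Csub (gam f) (gam0 f)) ^ 2 <= real_value gam q.
Proof.
  intros H0; induction fs as [|f fs IH]; intros Hfs.
  - exists (fun _ => 0); split; [apply unital_closure_const|split].
    + now apply real_value_const.
    + intros gam Hgam. rewrite real_value_const by auto. split; [lra|easy].
  - destruct IH as [q [Hq [Hq0 Hqg]]]; [auto with datatypes|].
    assert (Hf : inAplus b c f) by auto with datatypes.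
    destruct (proj1 (inAplus_iff f) Hf) as [H1 H2].
    set (p := real_value gam0 (fun x => re (f x))).
    set (r := real_value gam0 (fun x => im (f x))).
    assert (K1 := unital_closure_sub_sq _ p H1). assert (K2 := unital_closure_sub_sq _ r H2).
    assert (K12 := unital_closure_plus _ _ K1 K2). simpl in *.
    exists (fun x => (re (f x) - p) * (re (f x) - p) + (im (f x) - r) * (im (f x) - r) + q x).
    assert (E : forall gam, character b c gam ->
      real_value gam (fun x => (re (f x) - p) * (re (f x) - p)
        + (im (f x) - r) * (im (f x) - r) + q x)
      = Cmod (Csub (gam f) (gam0 f)) ^ 2 + real_value gam q).
    { intros gam Hgam.
      rewrite (real_value_plus gam Hgam _ q K12 Hq), (real_value_plus gam Hgam _ _ K1 K2).
      rewrite (real_value_sub_sq gam (fun x => re (f x))) by auto.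
      rewrite (real_value_sub_sq gam (fun x => im (f x))) by auto.
      rewrite Cmod_sq, (character_re_im gam Hgam f Hf), (character_re_im gam0 H0 f Hf).
      simpl. fold p r. ring. }
    split; [now apply unital_closure_plus|split].
    + rewrite E, Hq0, Cmod_sq by auto. simpl. ring.
    + intros gam Hgam. rewrite E by auto. destruct (Hqg gam Hgam) as [G1 G2].
      assert (G3 := pow2_ge_0 (Cmod (Csub (gam f) (gam0 f)))).
      split; [lra|]. intros k [<-|Hk]; [lra|]. specialize (G2 k Hk); lra.
Qed.

Lemma boundary_continuous_re_im phi :
  continuous_on_boundary b c phi ->
  boundary_continuous (fun gam => re (phi gam)) /\ boundary_continuous (fun gam => im (phi gam)).
Proof.
  intros H.
  assert (K : forall gam0, in_boundary b c gam0 -> forall eps, 0 < eps ->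
    exists (q : X -> R) (d : R), unital_closure q /\ 0 < d /\ real_value gam0 q = 0 /\
    forall gam, in_boundary b c gam -> 0 <= real_value gam q /\
      (real_value gam q < d -> Cmod (Csub (phi gam) (phi gam0)) < eps)).
  { intros gam0 H0 eps He. destruct (H gam0 H0 eps He) as [fs [del [Hd [Hfs Hgam]]]].
    destruct (weak_neighbourhood_sublevel gam0 fs (proj1 H0) Hfs) as [q [Hq [Hq0 Hqg]]].
    exists q, (del ^ 2); repeat split; auto.
    - now apply pow_lt.
    - apply (Hqg gam (proj1 H1)).
    - intros Hlt. apply Hgam; auto. intros f Hf.
      assert (Hm := proj2 (Hqg gam (proj1 H1)) f Hf).
      assert (Hp := Cmod_nonneg (Csub (gam f) (gam0 f))). nra. }
  split; intros gam0 H0 eps He; destruct (K gam0 H0 eps He) as [q [d [Hq [Hd [Hq0 Hqg]]]]];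
    exists q, d; repeat split; auto; try apply Hqg; auto; intros Hlt;
    apply Rle_lt_trans with (2 := proj2 (Hqg gam H1) Hlt);
    [apply (Rabs_re_le (Csub (phi gam) (phi gam0)))
    |apply (Rabs_im_le (Csub (phi gam) (phi gam0)))].
Qed.

Lemma boundary_continuous_minus psi f :
  boundary_continuous psi -> unital_closure f ->
  boundary_continuous (fun gam => psi gam - real_value gam f).
Proof.
  intros Hpsi Hf gam0 H0 eps He.
  destruct (Hpsi gam0 H0 (eps / 2)) as [q [d [Hq [Hd [Hq0 Hqg]]]]]; [lra|].
  set (a := real_value gam0 f).
  assert (Hs := unital_closure_sub_sq f a Hf).
  exists (fun x => q x + (f x - a) * (f x - a)), (Rmin d ((eps / 2) ^ 2)).
  assert (E : forall gam, character b c gam ->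
    real_value gam (fun x => q x + (f x - a) * (f x - a))
    = real_value gam q + (real_value gam f - a) ^ 2).
  { intros gam Hgam. rewrite (real_value_plus gam Hgam q _ Hq Hs).
    now rewrite real_value_sub_sq. }
  repeat split.
  - now apply unital_closure_plus.
  - apply Rmin_glb_lt; auto. apply pow_lt; lra.
  - rewrite E, Hq0 by apply H0. unfold a; simpl; ring.
  - rewrite E by apply H. assert (H1 := proj1 (Hqg gam H)).
    assert (H2 := pow2_ge_0 (real_value gam f - a)). lra.
  - rewrite E by apply H. intros Hlt. destruct (Hqg gam H) as [H1 H2].
    assert (H3 := pow2_ge_0 (real_value gam f - a)).
    assert (L1 := Rmin_l d ((eps / 2) ^ 2)); assert (L2 := Rmin_r d ((eps / 2) ^ 2)).
    assert (H4 : Rabs (psi gam - psi gam0) < eps / 2) by (apply H2; lra).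
    assert (H5 : Rabs (real_value gam f - a) < eps / 2) by (apply Rabs_def1; nra).
    apply Rabs_def2 in H4, H5. fold a. apply Rabs_def1; lra.
Qed.

Lemma unital_closure_sum {I : Type} (f : I -> X -> R) (l : list I) :
  (forall i, In i l -> unital_closure (f i)) ->
  unital_closure (fun x => Rsum_list (fun i => f i x) l).
Proof.
  induction l as [|i l IH]; intros H; simpl; [apply unital_closure_const|].
  apply (unital_closure_plus (f i)); [apply H; simpl; auto|].
  apply IH; intros j Hj; apply H; simpl; auto.
Qed.

(* [F] comes from a partition of unity subordinate to a finite cover of the boundary by
   sets on which [psi] is [eps]-close to a value of [psi]. *)
Lemma boundary_approximation psi eps :
  boundary_continuous psi -> 0 < eps ->
  exists F, unital_closure F /\
    (forall gam, in_boundary b c gam -> Rabs (real_value gam F - psi gam) <= eps) /\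
    (forall M, 0 <= M -> (forall gam, in_boundary b c gam -> Rabs (psi gam) <= M) ->
      forall x, Rabs (F x) <= M).
Proof.
  intros Hpsi He.
  (* Pairs of a value of [psi] and a function whose positivity set lies where [psi] is [eps]-close
     to that value. That the first component is a value of [psi] serves the final sup bound. *)
  set (P := fun p : R * (X -> R) => unital_closure (snd p) /\
    (exists gam0, in_boundary b c gam0 /\ fst p = psi gam0) /\
    forall gam, in_boundary b c gam -> 0 < real_value gam (snd p) ->
      Rabs (psi gam - fst p) < eps).
  destruct (boundary_compact (fun p : R * (X -> R) => snd p) P)
    as [ps [d [l [Hps [Hd Hcov]]]]].
  - intros p Hp; apply Hp.
  - intros gam0 H0. destruct (Hpsi gam0 H0 eps He) as [q [d [Hq [Hd [Hq0 Hqg]]]]].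
    assert (Hc := unital_closure_const d).
    exists (psi gam0, fun x => d - q x); split; [split; [|split]|]; simpl.
    + now apply unital_closure_minus.
    + eauto.
    + intros gam Hgam Hpos. apply Hqg; auto.
      rewrite (real_value_minus gam (proj1 Hgam) (fun _ => d) q Hc Hq),
        (real_value_const gam (proj1 Hgam)) in Hpos. lra.
    + rewrite (real_value_minus gam0 (proj1 H0) (fun _ => d) q Hc Hq),
        (real_value_const gam0 (proj1 H0)), Hq0. lra.
  (* The cut at [d / 2] leaves room on both sides. Off [l] some [h p x] is at least [d / 2], so the
     truncated denominator of [F] equals [S]; and [h p x <> 0] means [snd p x > d / 2], which keeps
     the value of [gam] positive when it is within [d / 2]. *)
  - set (h := fun (p : R * (X -> R)) (x : X) => Rmax 0 (snd p x - d / 2)).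
    set (N := fun x => Rsum_list (fun p => fst p * h p x) ps).
    set (S := fun x => Rsum_list (fun p => h p x) ps).
    set (F := fun x => N x * / Rmax (d / 2) (S x)).
    assert (Hh0 : forall p x, 0 <= h p x) by (intros; apply Rmax_l).
    assert (Hh : forall p, In p ps -> unital_closure (h p)).
    { intros p Hp. apply (unital_closure_lipschitz 1 (fun u => Rmax 0 (u - d / 2))).
      - intros u v. unfold Rmax; repeat destruct Rle_dec; unfold Rabs;
          repeat destruct Rcase_abs; lra.
      - apply (Hps p Hp). }
    assert (HN : unital_closure N).
    { apply (unital_closure_sum (fun p x => fst p * h p x)).
      intros p Hp; apply unital_closure_scal, Hh, Hp. }
    assert (HS : unital_closure S) by now apply unital_closure_sum.
    assert (Hd2 : 0 < d / 2) by lra.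
    assert (HF : unital_closure F).
    { apply unital_closure_mult; auto.
      exact (unital_closure_lipschitz _ _ _ (lipschitz_inv_Rmax (d / 2) Hd2) HS). }
    exists F; split; [auto|split].
    + intros gam Hgam. apply le_epsilon; intros eta Heta.
      destruct (boundary_dense gam (F :: map snd ps) l (Rmin eta (d / 2)) Hgam)
        as [x [Hx Hfx]].
      * intros f [<-|Hf]; auto. apply in_map_iff in Hf. destruct Hf as [p [<- Hp]].
        apply (Hps p Hp).
      * now apply Rmin_glb_lt.
      * assert (HSx : d / 2 <= S x).
        { destruct (Hcov x Hx) as [p [Hp Hpx]].
          apply Rle_trans with (h p x).
          - unfold h. apply Rle_trans with (2 := Rmax_r _ _). lra.
          - replace (h p x) with (Rsum_list (fun p => h p x) [p]) by (simpl; lra).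
            apply Rsum_list_incl; [intros; apply Hh0|repeat constructor; easy|].
            intros k [<-|[]]; auto. }
        assert (Hclose := weighted_sum_close fst (fun p => h p x) (psi gam) eps ps
          (fun p => Hh0 p x)). fold (N x) (S x) in Hclose.
        assert (HFx : Rabs (F x - psi gam) <= eps).
        { replace (F x - psi gam) with ((N x - psi gam * S x) * / S x)
            by (unfold F; rewrite Rmax_right by auto; field; lra).
          assert (Hi : 0 < / S x) by (apply Rinv_0_lt_compat; lra).
          rewrite Rabs_mult, (Rabs_pos_eq (/ S x)) by lra.
          replace eps with (eps * S x * / S x) by (field; lra).
          apply Rmult_le_compat_r; [lra|]. apply Hclose.
          intros p Hp Hne. rewrite Rabs_minus_sym. left.
          apply (Hps p Hp); auto.
          assert (Hs := Hfx (snd p) (or_intror (in_map snd _ _ Hp))).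
          assert (Hm := Rmin_r eta (d / 2)). apply Rabs_def2 in Hs.
          assert (d / 2 < snd p x); [|lra].
          apply Rnot_le_lt; intros Hle. apply Hne. unfold h. apply Rmax_left; lra. }
        assert (H1 := Hfx F (or_introl eq_refl)). assert (Hm := Rmin_l eta (d / 2)).
        apply Rabs_def2 in H1. apply Rabs_le_inv in HFx. apply Rabs_le; lra.
    (* This bound covers the vertices of [l] too, as the denominator dominates [S] everywhere. *)
    + intros M HM Hb x.
      assert (Hclose := weighted_sum_close fst (fun p => h p x) 0 M ps (fun p => Hh0 p x)).
      fold (N x) (S x) in Hclose. rewrite Rmult_0_l, Rminus_0_r in Hclose.
      assert (HNx : Rabs (N x) <= M * S x).
      { apply Hclose. intros p Hp _. rewrite Rminus_0_r.
        destruct (proj1 (proj2 (Hps p Hp))) as [gam0 [H0 ->]]. auto. }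
      unfold F. set (r := Rmax (d / 2) (S x)).
      assert (Hr1 : d / 2 <= r) by apply Rmax_l. assert (Hr2 : S x <= r) by apply Rmax_r.
      assert (Hi : 0 < / r) by (apply Rinv_0_lt_compat; lra).
      rewrite Rabs_mult, (Rabs_pos_eq (/ r)) by lra.
      replace M with (M * r * / r) by (field; lra).
      apply Rmult_le_compat_r; [lra|]. apply Rle_trans with (1 := HNx).
      now apply Rmult_le_compat_l.
Qed.

(** Errors are corrected successively: an error of [(/ 2) ^ n] on the boundary bounds the next
    correction on all of [X], so the corrections form a geometrically convergent series. *)
Lemma boundary_extension psi :
  boundary_continuous psi ->
  exists F, unital_closure F /\
    forall gam, in_boundary b c gam -> real_value gam F = psi gam.
Proof.
  intros Hpsi.
  set (good := fun (n : nat) F => unital_closure F /\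
    forall gam, in_boundary b c gam -> Rabs (real_value gam F - psi gam) <= (/ 2) ^ n).
  assert (Hpow : forall n, 0 < (/ 2) ^ n) by (intros; apply pow_lt; lra).
  (* Stated as an implication so that choice yields a step function on all pairs, good or not. *)
  assert (Hstep : forall a : nat * (X -> R), exists F', good (fst a) (snd a) ->
    good (S (fst a)) F' /\ forall x, Rabs (F' x - snd a x) <= (/ 2) ^ fst a).
  { intros [n F]; simpl. destruct (classic (good n F)) as [[HF Hn]|Hn];
      [|exists F; tauto].
    destruct (boundary_approximation (fun gam => psi gam - real_value gam F)
      ((/ 2) ^ S n)) as [E [HE [HE1 HE2]]]; auto.
    { now apply boundary_continuous_minus. }
    exists (fun x => F x + E x). intros _. split; [split|].
    - now apply unital_closure_plus.
    - intros gam Hgam. rewrite (real_value_plus gam (proj1 Hgam)) by auto.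
      specialize (HE1 gam Hgam). rewrite Rabs_minus_sym in HE1 |- *.
      replace (psi gam - (real_value gam F + real_value gam E))
        with (psi gam - real_value gam F - real_value gam E) by ring. exact HE1.
    - intros x. replace (F x + E x - F x) with (E x) by ring.
      apply HE2; [left; auto|]. intros gam Hgam. rewrite Rabs_minus_sym; auto. }
  apply choice_fun in Hstep. destruct Hstep as [step Hstep].
  destruct (boundary_approximation psi 1 Hpsi Rlt_0_1) as [F0 [HF0 [HF01 _]]].
  set (G := fix G n := match n with O => F0 | Datatypes.S k => step (k, G k) end).
  assert (HG : forall n, good n (G n)).
  { induction n as [|n IH]; [now split|]. exact (proj1 (Hstep (n, G n) IH)). }
  assert (HGs : forall n x, Rabs (G (S n) x - G n x) <= (/ 2) ^ n).
  { intros n. exact (proj2 (Hstep (n, G n) (HG n))). }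
  assert (HGk : forall k n x,
    Rabs (G (k + n)%nat x - G n x) <= 2 * (/ 2) ^ n - 2 * (/ 2) ^ (k + n)).
  { induction k as [|k IH]; intros n x.
    - simpl. rewrite Rminus_diag, Rabs_R0; lra.
    - specialize (IH n x). assert (H := HGs (k + n)%nat x).
      apply Rabs_le_inv in IH, H. change (S k + n)%nat with (S (k + n)).
      simpl pow. apply Rabs_le; lra. }
  destruct (uniform_limit G (fun n => 2 * (/ 2) ^ n)) as [F HF].
  - apply half_pow_eventually.
  - intros n m x. assert (P1 := Hpow n); assert (P2 := Hpow m).
    destruct (Nat.le_ge_cases n m) as [Hle|Hle].
    + replace m with ((m - n) + n)%nat by lia. rewrite Rabs_minus_sym.
      apply Rle_trans with (1 := HGk _ _ _).
      assert (P3 := Hpow (m - n + n)%nat). lra.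
    + replace n with ((n - m) + m)%nat by lia.
      apply Rle_trans with (1 := HGk _ _ _).
      assert (P3 := Hpow (n - m + m)%nat). lra.
  - assert (HFc : unital_closure F).
    { apply unital_closure_closed. intros eps He.
      destruct (half_pow_eventually eps He) as [n Hn].
      exists (G n); split; [apply HG|]. intros x.
      apply Rle_trans with (1 := HF n x). left; apply Hn; lia. }
    exists F; split; auto. intros gam Hgam. apply cond_eq; intros eps He.
    destruct (half_pow_eventually (eps / 2)) as [n Hn]; [lra|].
    specialize (Hn n (Nat.le_refl _)). destruct (HG n) as [HGn Hpn].
    assert (H1 := real_value_dist gam (proj1 Hgam) F (G n) _ HFc HGn (HF n)).
    specialize (Hpn gam Hgam). apply Rabs_le_inv in H1, Hpn.
    assert (P := Hpow n). apply Rabs_def1; lra.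
Qed.

(** * The character at infinity *)

Lemma inA_plus f g : inA b c f -> inA b c g -> inA b c (fun x => Cadd (f x) (g x)).
Proof.
  intros Hf Hg'. apply inA_iff in Hf, Hg'. apply inA_iff; simpl.
  split; now apply energy_closure_plus.
Qed.

Lemma inA_mult f g : inA b c f -> inA b c g -> inA b c (fun x => Cmul (f x) (g x)).
Proof.
  intros Hf Hg'. apply inA_iff in Hf, Hg'. destruct Hf as [F1 F2], Hg' as [G1 G2].
  apply inA_iff; simpl; split.
  - replace (fun x => re (f x) * re (g x) - im (f x) * im (g x))
      with (fun x => re (f x) * re (g x) + -1 * (im (f x) * im (g x)))
      by (apply functional_extensionality; intros; ring).
    apply energy_closure_plus; [now apply energy_closure_mult|].
    apply energy_closure_scal; now apply energy_closure_mult.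
  - apply energy_closure_plus; now apply energy_closure_mult.
Qed.

Lemma inA_scal z f : inA b c f -> inA b c (fun x => Cmul z (f x)).
Proof.
  intros Hf. apply inA_iff in Hf. destruct Hf as [F1 F2]. apply inA_iff; simpl; split.
  - replace (fun x => re z * re (f x) - im z * im (f x))
      with (fun x => re z * re (f x) + - im z * im (f x))
      by (apply functional_extensionality; intros; ring).
    apply energy_closure_plus; now apply energy_closure_scal.
  - apply energy_closure_plus; now apply energy_closure_scal.
Qed.

Lemma inAplus_shift f : inAplus b c f -> exists a, inA b c (fun x => Csub (f x) a).
Proof.
  intros Hf. destruct (proj1 (inAplus_iff f) Hf) as [[p Hp] [q Hq]].
  exists (mkC p q). apply inA_iff; now split.
Qed.

Lemma gamma_inf_spec f : inAplus b c f -> inA b c (fun x => Csub (f x) (gamma_inf b c f)).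
Proof.
  intros Hf.
  exact (epsilon_spec (inhabits C0) (fun a => inA b c (fun x => Csub (f x) a))
    (inAplus_shift f Hf)).
Qed.

(** When [c] is not summable the constant part is unique, so the choice in [gamma_inf] is
    determined. *)
Lemma gamma_inf_eq f a :
  ~ summable_nonneg c -> inA b c (fun x => Csub (f x) a) -> gamma_inf b c f = a.
Proof.
  intros Hc Ha.
  assert (H : inA b c (fun x => Csub (f x) (gamma_inf b c f))).
  { apply (epsilon_spec (inhabits C0) (fun a => inA b c (fun x => Csub (f x) a))); eauto. }
  apply inA_iff in Ha, H. destruct Ha as [A1 A2], H as [H1 H2]. simpl in *.
  apply Cplx_eq.
  - exact (energy_closure_shift_unique (fun x => re (f x)) _ _ Hc H1 A1).
  - exact (energy_closure_shift_unique (fun x => im (f x)) _ _ Hc H2 A2).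
Qed.

Lemma gamma_inf_boundary : ~ summable_nonneg c -> in_boundary b c (gamma_inf b c).
Proof.
  intros Hc. split; [split; [|split; [|split]]|].
  - intros f g Hf Hg'. apply gamma_inf_eq; auto.
    assert (H := inA_plus _ _ (gamma_inf_spec f Hf) (gamma_inf_spec g Hg')).
    eapply eq_ind with (1 := H). apply functional_extensionality; intros x.
    apply Cplx_eq; simpl; ring.
  - intros a f Hf. apply gamma_inf_eq; auto.
    assert (H := inA_scal a _ (gamma_inf_spec f Hf)).
    eapply eq_ind with (1 := H). apply functional_extensionality; intros x.
    apply Cplx_eq; simpl; ring.
  - intros f g Hf Hg'. apply gamma_inf_eq; auto.
    assert (F := gamma_inf_spec f Hf). assert (G := gamma_inf_spec g Hg').
    (* With [a] and [a'] the constant parts of [f] and [g], this is [f * g - a * a' = (f - a) * (g -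
       a') + a * (g - a') + a' * (f - a)]. *)
    assert (H := inA_plus _ _ (inA_mult _ _ F G)
      (inA_plus _ _ (inA_scal (gamma_inf b c f) _ G) (inA_scal (gamma_inf b c g) _ F))).
    eapply eq_ind with (1 := H). apply functional_extensionality; intros x.
    apply Cplx_eq; simpl; ring.
  - exists one; split; [exact (inAplus_const Defs.C1)|].
    rewrite (gamma_inf_eq one Defs.C1 Hc).
    + intros E; apply (f_equal re) in E; simpl in E; lra.
    + assert (H0 : energy_closure (fun _ => 0)).
      { apply finite_energy_closure, finite_support_energy. now exists []. }
      apply inA_iff; simpl. now rewrite Rplus_opp_r, Ropp_0, Rplus_0_r.
  - intros y E. specialize (E _ (inAplus_real _ (unital_closure_indicator y))).
    rewrite (gamma_inf_eq _ C0 Hc) in E.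
    + unfold delta in E. rewrite indicator_eq in E.
      apply (f_equal re) in E; simpl in E; lra.
    + apply inA_iff; simpl. split; apply finite_energy_closure, finite_support_energy.
      * destruct (finite_support_indicator y) as [l Hl]. exists l; intros x Hx.
        rewrite Hl by auto. ring.
      * exists []; intros; ring.
Qed.

(** * Harmonic functions with prescribed boundary values *)

Lemma Lap_eq (f : X -> Cplx) x p q :
  laplacian (fun y => re (f y)) x p -> laplacian (fun y => im (f y)) x q ->
  Lap b c f x = mkC p q.
Proof.
  intros Hp Hq. unfold Lap.
  rewrite (C_has_sum_Ctsum _ (p - c x * re (f x)) (q - c x * im (f x))).
  - apply Cplx_eq; simpl; ring.
  - eapply has_sum_ext; [|exact Hp]. intros y; simpl; ring.
  - eapply has_sum_ext; [|exact Hq]. intros y; simpl; ring.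
Qed.

Lemma Lap_zero_iff (f : X -> Cplx) x :
  inA b c f ->
  (Lap b c f x = C0 <->
   laplacian (fun y => re (f y)) x 0 /\ laplacian (fun y => im (f y)) x 0).
Proof.
  intros Hf. apply inA_iff in Hf. destruct Hf as [H1 H2].
  destruct (energy_closure_bounded _ H1) as [M1 HM1].
  destruct (energy_closure_bounded _ H2) as [M2 HM2].
  destruct (laplacian_exists _ x _ HM1) as [p Hp].
  destruct (laplacian_exists _ x _ HM2) as [q Hq].
  split.
  - rewrite (Lap_eq f x p q Hp Hq). intros E. injection E as -> ->. now split.
  - intros [K1 K2]. exact (Lap_eq f x 0 0 K1 K2).
Qed.

Lemma energy_closure_minus f g :
  energy_closure f -> energy_closure g -> energy_closure (fun x => f x - g x).
Proof.
  intros Hf Hg'. replace (fun x => f x - g x) with (fun x => f x + -1 * g x)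
    by (apply functional_extensionality; intros; ring).
  now apply energy_closure_plus, energy_closure_scal.
Qed.

Lemma harmonic_boundary_unique u v :
  energy_closure u -> energy_closure v ->
  (forall x, laplacian u x 0) -> (forall x, laplacian v x 0) ->
  (forall gam, in_boundary b c gam -> real_value gam u = real_value gam v) ->
  forall x, u x = v x.
Proof.
  intros Hu Hv Lu Lv Huv x.
  assert (Hw : vanishing (fun x => u x - v x)).
  { apply vanishing_of_boundary.
    - now apply energy_closure_unital, energy_closure_minus.
    - intros gam Hgam. apply energy_closure_unital in Hu, Hv.
      rewrite (real_value_minus gam (proj1 Hgam) u v Hu Hv), Huv by auto. ring. }
  assert (H : Rabs (u x - v x) <= 0).
  { apply (maximum_principle_abs (fun x => u x - v x)); [lra| |].
    - intros y. replace 0 with (0 - 0) by ring. now apply laplacian_minus.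
    - intros eps He. rewrite Rplus_0_l. auto. }
  apply Rabs_le_inv in H. lra.
Qed.

Lemma harmonic_boundary_exists F :
  energy_closure F ->
  exists u, energy_closure u /\ (forall x, laplacian u x 0) /\
    forall gam, in_boundary b c gam -> real_value gam u = real_value gam F.
Proof.
  intros HF. destruct (dirichlet_closure F HF) as [u [Hu [Lu Hv]]].
  exists u; split; [auto|split; auto]. intros gam Hgam.
  assert (E := boundary_vanishing gam _ Hgam
    (energy_closure_unital _ (energy_closure_minus u F Hu HF)) Hv).
  apply energy_closure_unital in Hu, HF.
  rewrite (real_value_minus gam (proj1 Hgam) u F Hu HF) in E. lra.
Qed.

Lemma boundary_extension_inA phi :
  in_C0_boundary b c phi ->
  exists F, inA b c F /\ forall gam, in_boundary b c gam -> gam F = phi gam.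
Proof.
  intros [Hcont Hinf]. destruct (boundary_continuous_re_im phi Hcont) as [C1 C2].
  destruct (boundary_extension _ C1) as [F1 [HF1 E1]].
  destruct (boundary_extension _ C2) as [F2 [HF2 E2]].
  set (F := fun x => mkC (F1 x) (F2 x)).
  assert (HF : inAplus b c F) by (apply inAplus_iff; now split).
  assert (E : forall gam, in_boundary b c gam -> gam F = phi gam).
  { intros gam Hgam. rewrite (character_re_im gam (proj1 Hgam) F HF).
    apply Cplx_eq; simpl; auto. }
  exists F; split; auto.
  (* If [c] is summable, the constant part of [F] already belongs to [inA]. *)
  destruct (classic (summable_nonneg c)) as [Hc|Hc].
  - destruct (inAplus_shift F HF) as [a Ha].
    assert (Hca : inA b c (fun _ => a)).
    { apply inA_iff; split; now apply energy_closure_const. }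
    eapply eq_ind with (1 := inA_plus _ _ Ha Hca).
    apply functional_extensionality; intros x. apply Cplx_eq; simpl; ring.
  (* Here the constant part of [F] is its value at [gamma_inf], that is [phi (gamma_inf b c)], which
     is zero by assumption. *)
  - assert (H := gamma_inf_spec F HF).
    rewrite E, Hinf in H by auto using gamma_inf_boundary.
    eapply eq_ind with (1 := H).
    apply functional_extensionality; intros x. apply Cplx_eq; simpl; ring.
Qed.

End Graph.

Theorem mainTheorem13 (X : Type) (b : X -> X -> Rdefinitions.R) (c : X -> Rdefinitions.R)
  (HX : countably_infinite X) (Hg : weighted_graph b c) (Hconn : connected b)
  (Hcc : canonically_compactifiable b c)
  (phi : ((X -> Cplx) -> Cplx) -> Cplx) (Hphi : in_C0_boundary b c phi) :
  exists! u : X -> Cplx,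
    inA b c u /\ (forall x : X, Lap b c u x = C0) /\
    (forall gam, in_boundary b c gam -> gam u = phi gam).
Proof.
  assert (HAp : forall f, inA b c f -> inAplus b c f).
  { intros f Hf S _ HS _. now apply HS. }
  destruct (boundary_extension_inA b c HX Hg Hcc phi Hphi) as [F [HF EF]].
  destruct (proj1 (inA_iff b c Hg Hcc F) HF) as [HF1 HF2].
  destruct (harmonic_boundary_exists b c HX Hg Hconn Hcc _ HF1) as [u1 [Hu1 [Lu1 B1]]].
  destruct (harmonic_boundary_exists b c HX Hg Hconn Hcc _ HF2) as [u2 [Hu2 [Lu2 B2]]].
  assert (Hu : inA b c (fun x => mkC (u1 x) (u2 x)))
    by (apply inA_iff; auto).
  exists (fun x => mkC (u1 x) (u2 x)); split; [split; [auto|split]|].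
  - intros x. apply Lap_zero_iff; auto.
  - intros gam Hgam. rewrite <- EF by auto.
    rewrite (character_re_im b c HX Hg Hcc gam (proj1 Hgam) F) by auto.
    rewrite (character_re_im b c HX Hg Hcc gam (proj1 Hgam)) by auto.
    rewrite <- B1, <- B2 by auto. reflexivity.
  - intros v [Hv [Lv Bv]]. destruct (proj1 (inA_iff b c Hg Hcc v) Hv) as [Hv1 Hv2].
    assert (Bv' : forall gam, in_boundary b c gam ->
      real_value gam u1 = real_value gam (fun x => re (v x)) /\
      real_value gam u2 = real_value gam (fun x => im (v x))).
    { intros gam Hgam. rewrite B1, B2 by auto.
      assert (E := Bv gam Hgam). rewrite <- EF in E by auto.
      rewrite (character_re_im b c HX Hg Hcc gam (proj1 Hgam) F) in E by auto.
      rewrite (character_re_im b c HX Hg Hcc gam (proj1 Hgam) v) in E by auto.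
      injection E as -> ->. auto. }
    assert (Lv' : forall x, laplacian b c (fun y => re (v y)) x 0 /\
      laplacian b c (fun y => im (v y)) x 0).
    { intros x. apply Lap_zero_iff; auto. }
    apply functional_extensionality; intros x. apply Cplx_eq; simpl.
    + apply (harmonic_boundary_unique b c HX Hg Hconn Hcc u1 (fun x => re (v x))); auto;
        [apply Lv'|apply Bv'].
    + apply (harmonic_boundary_unique b c HX Hg Hconn Hcc u2 (fun x => im (v x))); auto;
        [apply Lv'|apply Bv'].
Qed.
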